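(* Suppose $f$ satisfies (F1), (F2), (F3), (F4). Let $q>3$, let $\rho_K\in L^q(K)$ be non-negative and axisymmetric, and let $\Phi_K(\mathbf{x})=\int_K\frac{\rho_K(\mathbf{y})}{|\mathbf{x}-\mathbf{y}|}d\mathbf{y}$. Assume $K$ satisfies the no-trapping condition: whenever $(x,y,z)\in\mathbb{R}^3\setminus K$, the half line $\{(x,y,z)+t(x,y,0):t\ge0\}$ is contained in $\mathbb{R}^3\setminus K$. Let $M>0$. Then there exists $\Omega_0>0$ such that for every constant $\Omega>\Omega_0$ there is no bounded continuous function $\rho:\mathbb{R}^3\setminus K\to[0,\infty)$ with $\int_{\mathbb{R}^3\setminus K}\rho\,d\mathbf{x}=M$ for which there is a constant $\lambda$ with $$A'(\rho)-B\rho-\tfrac12\Omega^2r^2-\Phi_K=\lambda\quad\text{on the set where }\rho>0.$$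
   Context: $K\subset\mathbb{R}^3$ is a bounded axisymmetric domain (axisymmetric means invariant under all rotations about the $x_3$-axis). Write $r=r(\mathbf{x})=\sqrt{x_1^2+x_2^2}$. For a function $\rho$ on $\mathbb{R}^3\setminus K$, $B\rho(\mathbf{x})=\int_{\mathbb{R}^3\setminus K}\frac{\rho(\mathbf{y})}{|\mathbf{x}-\mathbf{y}|}\,d\mathbf{y}$. Conditions on $f:[0,\infty)\to[0,\infty)$: (F1) $f$ is non-negative, continuous, and strictly increasing for $s>0$; (F2) $\lim_{s\to0}f(s)s^{-4/3}=0$ and $\lim_{s\to\infty}f(s)s^{-4/3}=\infty$; (F3) $\liminf_{s\to\infty}f(s)s^{-\gamma}>0$ for some $\gamma>4/3$; (F4) $f$ is continuously differentiable on $(0,\infty)$ and $\liminf_{s\to0}f'(s)s^{-\mu}>0$ for some $\mu>0$. $A(s)=s\int_0^s\frac{f(t)}{t^2}dt$, so $A'(s)=\int_0^s\frac{f(t)}{t^2}dt+\frac{f(s)}{s}$. *)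

(* Defs.v *)
From HB Require Import structures.
From mathcomp Require Import all_boot all_order all_algebra.
From mathcomp Require Import all_classical all_reals all_analysis.
Set Implicit Arguments. Unset Strict Implicit. Unset Printing Implicit Defensive.
Import Order.TTheory GRing.Theory Num.Theory.
Import numFieldNormedType.Exports.
Local Open Scope classical_set_scope.
Local Open Scope ring_scope.

(* Points of R^3 are triples ((x1, x2), x3); R^3 carries the product
   topology and the product Lebesgue measure. *)
Section Defs.
Variable R : realType.

Definition pt := ((R * R) * R)%type.

Definition leb3 : set pt -> \bar R :=
  ((@lebesgue_measure R \x @lebesgue_measure R) \x @lebesgue_measure R)%E.

Definition enorm3 (p : pt) : R :=
  Num.sqrt (p.1.1 ^+ 2 + p.1.2 ^+ 2 + p.2 ^+ 2).
Definition dist3 (p q : pt) : R :=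
  Num.sqrt ((p.1.1 - q.1.1) ^+ 2 + (p.1.2 - q.1.2) ^+ 2 + (p.2 - q.2) ^+ 2).

Definition rcyl (p : pt) : R := Num.sqrt (p.1.1 ^+ 2 + p.1.2 ^+ 2).

Definition rot3 (th : R) (p : pt) : pt :=
  ((cos th * p.1.1 - sin th * p.1.2, sin th * p.1.1 + cos th * p.1.2), p.2).

Definition axisym_set (K : set pt) : Prop :=
  forall th p, K p -> K (rot3 th p).

Definition axisym_fun (g : pt -> R) : Prop :=
  forall th p, g (rot3 th p) = g p.

Definition bounded_domain (K : set pt) : Prop :=
  open K /\ connected K /\ K !=set0 /\ exists C : R, forall p, K p -> enorm3 p <= C.

Definition no_trapping (K : set pt) : Prop :=
  forall p : pt, ~ K p -> forall t : R, 0 <= t ->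
    ~ K ((p.1.1 + t * p.1.1, p.1.2 + t * p.1.2), p.2).

Definition in_Lq (q : R) (K : set pt) (g : pt -> R) : Prop :=
  measurable_fun K g /\
  (\int[leb3]_(y in K) ((`|g y| `^ q)%:E) < +oo)%E.

Definition newton_pot (D : set pt) (g : pt -> R) (x : pt) : R :=
  fine (\int[leb3]_(y in D) ((g y / dist3 x y)%:E)).

Definition PhiK (K : set pt) (rhoK : pt -> R) : pt -> R := newton_pot K rhoK.
Definition Bop (K : set pt) (rho : pt -> R) : pt -> R := newton_pot (~` K) rho.

Definition Aprime (f : R -> R) (s : R) : R :=
  fine (\int[@lebesgue_measure R]_(t in `]0, s]) ((f t / t ^+ 2)%:E)) + f s / s.

Definition F1 (f : R -> R) : Prop :=
  (forall s, 0 <= s -> 0 <= f s) /\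
  {within `[0, +oo[, continuous f} /\
  (forall s t, 0 < s -> s < t -> f s < f t).

Definition F2 (f : R -> R) : Prop :=
  (fun s => f s * s `^ (- (4 / 3))) @ 0^'+ --> 0 /\
  (fun s => f s * s `^ (- (4 / 3))) @ +oo --> +oo.

(* liminf_{s->oo} f(s) s^-gamma > 0, written out: eventually bounded below
   by a positive constant *)
Definition F3 (f : R -> R) : Prop :=
  exists gamma : R, 4 / 3 < gamma /\
    exists c : R, 0 < c /\ \forall s \near +oo, c <= f s * s `^ (- gamma).

Definition F4 (f : R -> R) : Prop :=
  (forall s, 0 < s -> derivable f s 1) /\
  {in `]0, +oo[, continuous (derive1 f)} /\
  exists mu : R, 0 < mu /\
    exists c : R, 0 < c /\ \forall s \near 0^'+, c <= (derive1 f) s * s `^ (- mu).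

End Defs.

(* Main.v *)
Require Import Defs.
From HB Require Import structures.
From mathcomp Require Import all_boot all_order all_algebra.
From mathcomp Require Import all_classical all_reals all_analysis.
From mathcomp Require Import measurable_realfun ring lra.
Set Implicit Arguments. Unset Strict Implicit. Unset Printing Implicit Defensive.
Import Order.TTheory GRing.Theory Num.Theory.
Import numFieldNormedType.Exports.
Local Open Scope classical_set_scope.
Local Open Scope ring_scope.

(* Where [rho > 0] the equation reads [A'(rho) = V] with
   [V = B rho + Phi_K + Omega^2 r^2 / 2 + lambda].  If [rho p > 0] off the axis and [V] stays
   above some [e > 0] on the outward radial ray from [p], then [rho] can never vanish along the
   ray (it would have to cross the small values [s] with [A'(s) < e]), and [V] tends to infinity
   while [A'(rho)] is bounded: contradiction.  This is used twice.
   - Near a supremum [S] of [rho], [A'(rho)] beats [B rho <= const * S^(1/3)] when [S] is large,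
     by (F2); hence [rho <= S] for some [S] independent of [Omega].
   - The mass cannot hide in the far field: for large [Omega] the Laplacian of [V] outside [K]
     exceeds any prescribed constant, so [A'(rho) - kappa |x - x0|^2] has no interior maximum on
     a unit cube around a point [x0] far from [K], although [kappa > A'(S)] would force one.
     Thus [rho] vanishes far from [K], and its mass [M] yields a point with [r >= tau] and
     [rho >= sigma], with [tau], [sigma] independent of [Omega].  By equicontinuity of the
     potentials and growth of [Omega^2 r^2 / 2], the ray from that point gives a contradiction.
   The Laplacian is handled through the six-point second difference, which is controlled for
   bounded densities without any regularity. *)

(** * Topology, measurability, Euclidean distance and volume on [pt R] *)

Section Points.
Variable R : realType.
Implicit Types (x y z : pt R) (e : R).

Lemma ball_pt x e y : ball x e y <->
  [/\ `|x.1.1 - y.1.1| < e, `|x.1.2 - y.1.2| < e & `|x.2 - y.2| < e].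
Proof.
rewrite /ball /= /prod_ball /= /ball /= /prod_ball /=.
by split=> [[[? ?] ?]|[? ? ?]].
Qed.

Lemma ball_pt_setX x e : ball x e = (ball x.1.1 e `*` ball x.1.2 e) `*` ball x.2 e.
Proof. by []. Qed.

Lemma measurable_ball_pt x e : measurable (ball x e : set (pt R)).
Proof.
rewrite ball_pt_setX; apply: measurableX; first apply: measurableX.
all: exact: measurable_ball.
Qed.

Lemma rat_near (a e : R) : 0 < e -> exists q : rat, `|ratr q - a| < e.
Proof.
move=> e0; have : a < a + e by rewrite ltrDl.
move=> /rat_in_itvoo[q]; rewrite in_itv /= => /andP[aq qe]; exists q.
by rewrite ger0_norm ?subr_ge0 ?ltrBlDl// ltW.
Qed.

(** An open set is the union of the cubes with rational centre and radius [1/(n+1)] that it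
    contains. [F] replaces every other cube by the empty set, so the union runs over a countable
    index type. *)
Lemma open_pt_measurable (U : set (pt R)) : open U -> measurable U.
Proof.
move=> oU.
pose F (i : rat * rat * rat * nat) : set (pt R) :=
  let b := ball (((ratr i.1.1.1, ratr i.1.1.2), ratr i.1.2) : pt R) (i.2.+1%:R^-1) in
  if `[< b `<=` U >] then b else set0.
have -> : U = \bigcup_i F i.
  apply/seteqP; split=> [x Ux|x [i _]]; last first.
    by rewrite /F; case: asboolP => // sub; exact: sub.
  have /nbhs_ballP[e /= e0 xeU] : nbhs x U by exact: open_nbhs_nbhs.
  have [n] : exists n : nat, 0 + n.+1%:R^-1 < e / 2 :> R.
    by apply: ltr_add_invr; rewrite divr_gt0.
  rewrite add0r => ne.
  have n0 : 0 < n.+1%:R^-1 :> R by rewrite invr_gt0.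
  have [q1 h1] := rat_near x.1.1 n0.
  have [q2 h2] := rat_near x.1.2 n0.
  have [q3 h3] := rat_near x.2 n0.
  exists (((q1, q2), q3), n) => //; rewrite /F; case: asboolP => /=; last first.
    move=> []; move=> y yb; apply: xeU; rewrite (splitr e).
    apply: ball_triangle; last exact: le_ball (ltW ne) _ yb.
    apply: ball_sym; apply: le_ball (ltW ne) _ _.
    by apply/ball_pt.
  by move=> _; apply/ball_pt.
apply: countable_bigcupT_measurable => [|i]; first exact: countableP.
by rewrite /F; case: ifP => // _; exact: measurable_ball_pt.
Qed.

Lemma within_measurable (D : set (pt R)) (g : pt R -> R) :
  measurable D -> {within D, continuous g} -> measurable_fun D g.
Proof.
move=> mD /continuousP cg.
apply: (measurability _ (RGenOpens.measurableE R)).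
move=> _ [_ [a [b ->] <-]].
have oab : open (`]a, b[%classic : set R) by exact: interval_open.
have /open_subspaceP[V oV VD] := cg _ oab.
rewrite setIC -VD; apply: measurableI => //; exact: open_pt_measurable.
Qed.

Lemma continuous_pt_measurable (D : set (pt R)) (g : pt R -> R) :
  continuous g -> measurable_fun D g.
Proof.
move=> cg; apply: measurable_funTS; apply: within_measurable => //.
exact: continuous_subspaceT.
Qed.

Lemma continuous_ptP (g : pt R -> R) :
  (forall x e, 0 < e -> exists2 d, 0 < d & forall y, ball x d y -> `|g x - g y| < e) ->
  continuous g.
Proof.
move=> H x; apply/cvgrPdist_lt => e e0; have [d d0 Hd] := H x e e0.
suff : nbhs (x : pt R) [set t | `|g x - g t| < e] by [].
by apply/nbhs_ballP; exists d => //= y; exact: Hd.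
Qed.

Lemma within_ptP (D : set (pt R)) (g : pt R -> R) x e :
  {within D, continuous g} -> D x -> 0 < e ->
  exists2 d, 0 < d & forall y, D y -> ball x d y -> `|g x - g y| < e.
Proof.
move=> /subspace_continuousP cg Dx e0.
have /cvgrPdist_lt/(_ e e0) := cg x Dx.
rewrite near_withinE => H.
have : nbhs (x : pt R) [set t | D t -> `|g x - g t| < e] by [].
by move=> /nbhs_ballP[d /= d0 {}H]; exists d => // y Dy xy; exact: H.
Qed.

Lemma dist3_ge0 x y : 0 <= dist3 x y. Proof. exact: sqrtr_ge0. Qed.

Lemma dist3_sqr x y : dist3 x y ^+ 2 =
  (x.1.1 - y.1.1) ^+ 2 + (x.1.2 - y.1.2) ^+ 2 + (x.2 - y.2) ^+ 2.
Proof. by rewrite sqr_sqrtr// !addr_ge0// sqr_ge0. Qed.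

Lemma dist3C x y : dist3 x y = dist3 y x.
Proof.
rewrite /dist3; congr (Num.sqrt (_ + _ + _)).
all: by rewrite -sqrrN opprB.
Qed.

(** Lagrange's identity: the difference of the squares of the two sides is a sum of three
    squares. *)
Lemma cauchy_schwarz3 (a b c a' b' c' : R) :
  a * a' + b * b' + c * c' <=
  Num.sqrt (a ^+ 2 + b ^+ 2 + c ^+ 2) * Num.sqrt (a' ^+ 2 + b' ^+ 2 + c' ^+ 2).
Proof.
rewrite -sqrtrM ?addr_ge0 ?sqr_ge0// (le_trans (ler_norm _))// -sqrtr_sqr.
apply: ler_wsqrtr; rewrite -subr_ge0.
have -> : (a ^+ 2 + b ^+ 2 + c ^+ 2) * (a' ^+ 2 + b' ^+ 2 + c' ^+ 2) -
  (a * a' + b * b' + c * c') ^+ 2 =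
  (a * b' - b * a') ^+ 2 + (a * c' - c * a') ^+ 2 + (b * c' - c * b') ^+ 2 by ring.
by rewrite !addr_ge0// sqr_ge0.
Qed.

Lemma dist3_triangle y x z : dist3 x z <= dist3 x y + dist3 y z.
Proof.
rewrite -(ler_pXn2r (n:=2))// ?nnegrE ?addr_ge0 ?dist3_ge0//.
rewrite sqrrD !dist3_sqr.
have := cauchy_schwarz3 (x.1.1 - y.1.1) (x.1.2 - y.1.2) (x.2 - y.2)
  (y.1.1 - z.1.1) (y.1.2 - z.1.2) (y.2 - z.2).
rewrite -/(dist3 x y) -/(dist3 y z); lra.
Qed.

Lemma dist3_le_coord x y :
  dist3 x y <= `|x.1.1 - y.1.1| + `|x.1.2 - y.1.2| + `|x.2 - y.2|.
Proof.
rewrite -(ler_pXn2r (n:=2))// ?nnegrE ?addr_ge0 ?dist3_ge0// dist3_sqr.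
rewrite -(real_normK (num_real (x.1.1 - _))) -(real_normK (num_real (x.1.2 - _))).
rewrite -(real_normK (num_real (x.2 - _))).
have := normr_ge0 (x.1.1 - y.1.1); have := normr_ge0 (x.1.2 - y.1.2).
have := normr_ge0 (x.2 - y.2); nra.
Qed.

(** In the product structure [ball] is an open cube, controlled coordinate by coordinate; the factor
    3 counts the coordinates. *)
Lemma dist3_lt_ball x y e : ball x e y -> dist3 x y < 3 * e.
Proof. by move/ball_pt => [? ? ?]; have := dist3_le_coord x y; lra. Qed.

Lemma coord_le_dist3 x y : [/\ `|x.1.1 - y.1.1| <= dist3 x y,
  `|x.1.2 - y.1.2| <= dist3 x y & `|x.2 - y.2| <= dist3 x y].
Proof.
have h (a b : R) : 0 <= b -> `|a| <= Num.sqrt (a ^+ 2 + b).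
  by move=> b0; rewrite -sqrtr_sqr ler_wsqrtr// lerDl.
split.
- by rewrite /dist3 -addrA; apply: h; rewrite addr_ge0 ?sqr_ge0.
- rewrite /dist3 (addrC (_ ^+ 2) ((x.1.2 - _) ^+ 2)) -addrA; apply: h.
  by rewrite addr_ge0 ?sqr_ge0.
- by rewrite /dist3 [X in Num.sqrt X]addrC; apply: h; rewrite addr_ge0 ?sqr_ge0.
Qed.

Lemma dist3_lt_sub_ball x e : [set y | dist3 x y < e] `<=` ball x e.
Proof.
move=> y /= xy; apply/ball_pt; have [h1 h2 h3] := coord_le_dist3 x y.
by split; [exact: le_lt_trans h1 xy|exact: le_lt_trans h2 xy|exact: le_lt_trans h3 xy].
Qed.

Lemma dist3_continuous x : continuous (dist3 x).
Proof.
apply: continuous_ptP => y e e0; exists (e / 3) => [|z yz]; first by rewrite divr_gt0.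
have := dist3_lt_ball yz; rewrite mulrC divfK// => yze.
rewrite ltr_norml; have := dist3_triangle y x z; have := dist3_triangle z x y.
by rewrite (dist3C z y) => ? ?; apply/andP; split; lra.
Qed.

Lemma measurable_dist3 (D : set (pt R)) x : measurable_fun D (dist3 x).
Proof. by apply: continuous_pt_measurable; exact: dist3_continuous. Qed.

Lemma leb3_setX (A B C : set R) : measurable A -> measurable B -> measurable C ->
  leb3 ((A `*` B) `*` C) =
  (lebesgue_measure A * lebesgue_measure B * lebesgue_measure C)%E.
Proof.
move=> mA mB mC; have mX := measurableX mA mB.
transitivity ((lebesgue_measure \x lebesgue_measure) (A `*` B) * lebesgue_measure C)%E.
  exact: (@product_measure1E _ _ _ _ R (@lebesgue_measure R \x @lebesgue_measure R)%E
    (@lebesgue_measure R) _ _ mX mC).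
congr (_ * _)%E.
exact: (@product_measure1E _ _ _ _ R (@lebesgue_measure R) (@lebesgue_measure R) _ _ mA mB).
Qed.

Lemma leb3_cuboid (a b c r s t : R) : 0 <= r -> 0 <= s -> 0 <= t ->
  leb3 ((ball a r `*` ball b s) `*` ball c t) = (8 * r * s * t)%:E.
Proof.
move=> r0 s0 t0; rewrite leb3_setX; try exact: measurable_ball.
by rewrite !lebesgue_measure_ball// -!EFinM; congr EFin; ring.
Qed.

Lemma leb3_ball x e : 0 <= e -> leb3 (ball x e) = ((2 * e) ^+ 3)%:E.
Proof. by move=> e0; rewrite ball_pt_setX leb3_cuboid//; congr EFin; ring. Qed.

(** Allows the plane [x1 = 0] to be removed from every domain of integration later on. *)
Lemma leb3_plane : leb3 (([set 0] `*` [set: R]) `*` [set: R] : set (pt R)) = 0%E.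
Proof. by rewrite leb3_setX// lebesgue_measure_set1 !mul0e. Qed.

Let leb3_prod := ((@lebesgue_measure R \x @lebesgue_measure R) \x @lebesgue_measure R)%E.

Let leb3_set0 : @leb3 R set0 = 0%E.
Proof. exact: (measure0 leb3_prod). Qed.

Let leb3_ge0 (A : set (pt R)) : (0 <= leb3 A)%E.
Proof. exact: (measure_ge0 leb3_prod). Qed.

Let leb3_sigma_additive : semi_sigma_additive (@leb3 R).
Proof. exact: (@measure_semi_sigma_additive _ _ _ leb3_prod). Qed.

(* The product measure lives on the display of [measurableTypeR], whereas integrals over
   [pt R] use the default display; the two sigma-algebras coincide. *)
HB.instance Definition _ := isMeasure.Build _ _ _ (@leb3 R)
  leb3_set0 leb3_ge0 leb3_sigma_additive.

End Points.

(** * Geometric scales and integrals over dyadic pieces *)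

Lemma geometric_scale (R : realType) (b r a : R) : 1 < b -> 0 < r -> r < a ->
  exists k, a / b ^+ k.+1 <= r < a / b ^+ k.
Proof.
move=> b1 r0 ra.
have a0 : 0 < a by exact: lt_trans ra.
have b0 k : 0 < b ^+ k by rewrite exprn_gt0// (lt_trans _ b1).
have [n nP] : exists n, a / b ^+ n <= r.
  have [n nP] : exists n : nat, a / r <= n%:R * (b - 1).
    exists (Num.truncn (a / r / (b - 1))).+1.
    rewrite -ler_pdivrMr ?subr_gt0//; apply/ltW.
    by rewrite truncnS_gt.
  exists n; rewrite ler_pdivrMr// mulrC -ler_pdivrMr//; apply: le_trans nP _.
  elim: n => [|n IH]; first by rewrite mul0r.
  have : 1 <= b ^+ n by rewrite exprn_ege1// ltW.
  rewrite exprS -natr1; nra.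
have [[|k] kP kmin] := ex_minnP (ex_intro (fun n => a / b ^+ n <= r) n nP).
  by move: kP; rewrite expr0 divr1 leNgt ra.
exists k; rewrite kP/= ltNge; apply/negP => /kmin; by rewrite ltnn.
Qed.

Lemma halving_sum (R : realFieldType) (a : R) n :
  \sum_(0 <= k < n) a / 2 ^+ k = 2 * a - 2 * a / 2 ^+ n.
Proof.
elim: n => [|n IH]; first by rewrite big_geq// expr0 divr1 subrr.
by rewrite big_nat_recr//= IH exprS; field; rewrite expf_neq0.
Qed.

Section Dyadic.
Context (d : measure_display) (T : measurableType d) (R : realType).
Variable mu : {measure set T -> \bar R}.

(** On [D], [g] is at most the sum over [k] of [c k] times the indicator of [A k]; integrating term
    by term leaves a geometric series with sum [2 * a]. The pieces may overlap, so cubes can stand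
    in for shells. *)
Lemma dyadic_integral_le (D : set T) (g : T -> R) (A : nat -> set T) (c : nat -> R) (a : R) :
  measurable D -> measurable_fun D g -> (forall y, D y -> 0 <= g y) ->
  (forall k, measurable (A k)) -> (forall k, 0 <= c k) ->
  (forall y, D y -> 0 < g y -> exists2 k, A k y & g y <= c k) ->
  (forall k, (c k)%:E * mu (A k) <= (a / 2 ^+ k)%:E)%E ->
  (\int[mu]_(y in D) (g y)%:E <= (2 * a)%:E)%E.
Proof.
move=> mD mg g0 mA c0 cover small.
pose h k y : \bar R := ((c k)%:E * (\1_(A k) y)%:E)%E.
have h0 k y : (0 <= h k y)%E by rewrite mule_ge0// lee_fin.
have mh k (E : set T) : measurable_fun E (h k).
  apply: measurable_funeM; apply/measurable_EFinP.
  exact: measurable_indic.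
have ih k : (\int[mu]_(y in D) h k y <= (a / 2 ^+ k)%:E)%E.
  have m1 : measurable_fun D (fun y => (\1_(A k) y : R)%:E).
    by apply/measurable_EFinP; exact: measurable_indic.
  rewrite (ge0_integralZl _ mD m1) ?lee_fin//.
  apply: le_trans (small k); apply: lee_wpmul2l; first by rewrite lee_fin.
  by rewrite integral_indic// le_measure// inE//; exact: measurableI.
apply: (@le_trans _ _ (\int[mu]_(y in D) (\sum_(k <oo) h k y))%E).
  apply: ge0_le_integral => //.
  - exact/measurable_EFinP.
  - exact: ge0_emeasurable_sum.
  - move=> y Dy; have [gy|gy] := leP (g y) 0.
      by apply: (@le_trans _ _ 0%E); rewrite ?lee_fin//; exact: nneseries_ge0.
    have [k Ak gk] := cover y Dy gy.
    apply: (@le_trans _ _ (h k y)).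
      by rewrite /h indicE mem_set// mule1 lee_fin.
    rewrite (nneseriesD1 (n := k))//; apply: leeDl.
    exact: nneseries_ge0.
rewrite integral_nneseries//.
apply: lime_le.
  by apply: is_cvg_nneseries => k _ _; exact: integral_ge0.
near=> n.
apply: (@le_trans _ _ (\sum_(0 <= k < n) (a / 2 ^+ k)%:E)%E).
  by apply: lee_sum => k _; exact: ih.
have a0 : 0 <= a.
  have := small 0%N; rewrite expr0 divr1 -lee_fin; apply: le_trans.
  by rewrite mule_ge0// lee_fin.
rewrite sumEFin lee_fin.
by rewrite halving_sum gerBl divr_ge0// ?exprn_ge0// mulr_ge0.
Unshelve. all: by end_near. Qed.

End Dyadic.

(** * Integrals of the Newton kernel near its pole and of its fifth power away from it *)

Section Kernels.
Variable R : realType.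
Implicit Types (x y : pt R) (D : set (pt R)) (eta : R).

Lemma measurable_dist3V n D x : measurable_fun D (fun y => (dist3 x y)^-1 ^+ n).
Proof.
apply: measurable_funX.
have -> : (fun y => (dist3 x y)^-1) = (fun y => dist3 x y `^ (- 1)).
  by apply/funext => y; rewrite powR_inv1// dist3_ge0.
apply: (measurableT_comp (measurable_powR (- 1))); exact: measurable_dist3.
Qed.

Definition near_kernel x eta y : R :=
  if dist3 x y < eta then (dist3 x y)^-1 else 0.

(** The fifth power is the decay rate of the fourth derivatives of [1/|x - y|], which govern the
    error of the six-point second difference. *)
Definition far_kernel x eta y : R :=
  if dist3 x y < eta then 0 else (dist3 x y)^-1 ^+ 5.

Lemma near_kernel_ge0 x eta y : 0 <= near_kernel x eta y.
Proof. by rewrite /near_kernel; case: ifP => // _; rewrite invr_ge0 dist3_ge0. Qed.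

Lemma far_kernel_ge0 x eta y : 0 <= far_kernel x eta y.
Proof.
by rewrite /far_kernel; case: ifP => // _; rewrite exprn_ge0// invr_ge0 dist3_ge0.
Qed.

Lemma measurable_near_kernel D x eta : measurable_fun D (near_kernel x eta).
Proof.
apply: measurable_funTS; apply: measurable_fun_ifT.
- by apply: measurable_fun_ltr => //; exact: measurable_dist3.
- by have := @measurable_dist3V 1 setT x; under eq_fun do rewrite expr1.
- exact: measurable_cst.
Qed.

Lemma measurable_far_kernel D x eta : measurable_fun D (far_kernel x eta).
Proof.
apply: measurable_funTS; apply: measurable_fun_ifT.
- by apply: measurable_fun_ltr => //; exact: measurable_dist3.
- exact: measurable_cst.
- exact: measurable_dist3V.
Qed.

(** At distance about [eta / 2^k] the square is of order [4^k / eta^2], while the enclosing cube has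
    volume of order [eta^3 / 8^k]; the product decays like [2^-k]. *)
Lemma integral_near_kernel_sqr D x eta : measurable D -> 0 < eta ->
  (\int[@leb3 R]_(y in D) (near_kernel x eta y ^+ 2)%:E <= (64 * eta)%:E)%E.
Proof.
move=> mD e0.
have -> : 64 * eta = 2 * (32 * eta) by ring.
have p0 k : 0 < 2 ^+ k :> R by rewrite exprn_gt0.
apply: (@dyadic_integral_le _ _ _ _ D _ (fun k => ball x (eta / 2 ^+ k))
  (fun k => (2 ^+ k.+1 / eta) ^+ 2)) => //.
- by apply: measurable_funX; exact: measurable_near_kernel.
- by move=> y _; rewrite sqr_ge0.
- by move=> k; exact: measurable_ball_pt.
- by move=> k; rewrite sqr_ge0.
- move=> y _; rewrite /near_kernel; case: ifPn => [de|_]; last by rewrite expr0n ltxx.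
  (* The inverse of 0 is 0, so the kernel vanishes at its own pole and this point needs no
     covering. *)
  have [->|dn0 _] := eqVneq (dist3 x y) 0; first by rewrite invr0 expr0n ltxx.
  have d0 : 0 < dist3 x y by rewrite lt_def dn0 dist3_ge0.
  have [k /andP[k1 k2]] := geometric_scale (ltr1n R 2) d0 de.
  exists k; first exact: dist3_lt_sub_ball.
  rewrite ler_pXn2r// ?nnegrE ?invr_ge0 ?dist3_ge0//; last first.
    by rewrite divr_ge0// ltW.
  by rewrite -[leRHS]invrK lef_pV2 ?posrE ?invr_gt0 ?divr_gt0// invf_div.
- move=> k; rewrite /= leb3_ball; last by rewrite divr_ge0// ltW.
  rewrite -EFinM lee_fin le_eqVlt; apply/orP; left; apply/eqP.
  by rewrite (exprS 2 k); field; rewrite !gt_eqF.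
Qed.

(** Where the kernel is nonzero it exceeds [1 / eta], hence it is at most [eta] times its square. *)
Lemma integral_near_kernel D x eta : measurable D -> 0 < eta ->
  (\int[@leb3 R]_(y in D) (near_kernel x eta y)%:E <= (64 * eta ^+ 2)%:E)%E.
Proof.
move=> mD e0.
apply: (@le_trans _ _ (\int[@leb3 R]_(y in D) (eta%:E * (near_kernel x eta y ^+ 2)%:E))%E).
  apply: ge0_le_integral => //.
  - by move=> y _; rewrite lee_fin near_kernel_ge0.
  - by apply/measurable_EFinP; exact: measurable_near_kernel.
  - apply: measurable_funeM; apply/measurable_EFinP; apply: measurable_funX.
    exact: measurable_near_kernel.
  - move=> y _; rewrite -EFinM lee_fin /near_kernel; case: ifP => [de|_]; last first.
      by rewrite expr0n mulr0.
    have [->|dn0] := eqVneq (dist3 x y) 0; first by rewrite invr0 expr0n mulr0.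
    have d0 : 0 < dist3 x y by rewrite lt_def dn0 dist3_ge0.
    rewrite expr2 mulrA ler_peMl ?invr_ge0 ?dist3_ge0//.
    by rewrite ler_pdivlMr// mul1r ltW.
rewrite ge0_integralZl//; last 3 first.
- apply/measurable_EFinP; apply: measurable_funX; exact: measurable_near_kernel.
- by move=> y _; rewrite lee_fin sqr_ge0.
- by rewrite lee_fin ltW.
have -> : 64 * eta ^+ 2 = eta * (64 * eta) by ring.
rewrite EFinM; apply: lee_wpmul2l; first by rewrite lee_fin ltW.
exact: integral_near_kernel_sqr.
Qed.

(** Here the scales grow: at distance about [eta * 2^k] the kernel decays like [32^-k] against a
    volume growing like [8^k], which is better than the required [2^-k]. *)
Lemma integral_far_kernel D x eta : measurable D -> 0 < eta ->
  (\int[@leb3 R]_(y in D) (far_kernel x eta y)%:E <= (4096 / eta ^+ 2)%:E)%E.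
Proof.
move=> mD e0.
have -> : 4096 / eta ^+ 2 = 2 * (2048 / eta ^+ 2) by field; rewrite gt_eqF.
have p0 k : 0 < 2 ^+ k :> R by rewrite exprn_gt0.
apply: (@dyadic_integral_le _ _ _ _ D _ (fun k => ball x (eta * 2 ^+ k.+1))
  (fun k => (2 / eta / 2 ^+ k) ^+ 5)) => //.
- exact: measurable_far_kernel.
- by move=> y _; exact: far_kernel_ge0.
- by move=> k; exact: measurable_ball_pt.
- by move=> k; rewrite exprn_ge0// !divr_ge0// ltW.
- move=> y _; rewrite /far_kernel; case: ifPn; rewrite ?ltxx// -leNgt => de _.
  have d0 : 0 < dist3 x y by exact: lt_le_trans de.
  have i0 : 0 < (dist3 x y)^-1 by rewrite invr_gt0.
  have ie : (dist3 x y)^-1 < 2 / eta.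
    have : (dist3 x y)^-1 <= eta^-1 by rewrite lef_pV2.
    have : 0 < eta^-1 by rewrite invr_gt0.
    lra.
  have [k /andP[k1 k2]] := geometric_scale (ltr1n R 2) i0 ie.
  exists k.
    apply: dist3_lt_sub_ball => /=; move: k1.
    have -> : 2 / eta / 2 ^+ k.+1 = (eta * 2 ^+ k)^-1.
      by rewrite (exprS 2 k); field; rewrite !gt_eqF.
    rewrite lef_pV2 ?posrE ?mulr_gt0// => k1; apply: le_lt_trans k1 _.
    by rewrite (exprS 2 k) ltr_pM2l// ltr_pMl// ltr1n.
  by rewrite ler_pXn2r// ?nnegrE ltW// !divr_gt0.
- move=> k; rewrite /= leb3_ball; last by rewrite mulr_ge0// ltW.
  rewrite -EFinM lee_fin.
  have -> : (2 / eta / 2 ^+ k) ^+ 5 * (2 * (eta * 2 ^+ k.+1)) ^+ 3 =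
     2048 / eta ^+ 2 / 2 ^+ k / 2 ^+ k.
    by rewrite (exprS 2 k); field; rewrite !gt_eqF.
  have : 0 <= 2048 / eta ^+ 2 / 2 ^+ k.
    by rewrite divr_ge0 ?divr_ge0 ?exprn_ge0 ?ler0n// ltW.
  move: (_ / 2 ^+ k) => c c0.
  by rewrite ler_pdivrMr// ler_peMr// exprn_ege1// ler1n.
Qed.

End Kernels.

(** * The six-point second difference of the Newton kernel *)

Section SixPoints.
Variable R : realType.
Implicit Types (x y : pt R) (s : R).

Definition six_points x s : seq (pt R) :=
  [:: ((x.1.1 + s, x.1.2), x.2); ((x.1.1 - s, x.1.2), x.2);
      ((x.1.1, x.1.2 + s), x.2); ((x.1.1, x.1.2 - s), x.2);
      ((x.1.1, x.1.2), x.2 + s); ((x.1.1, x.1.2), x.2 - s)].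

(* The cubic Taylor polynomial of (1 + u)^(-1/2) is a lower bound, the fourth derivative
   being positive. *)
Lemma inv_sqrt_taylor (X t : R) : 0 < X -> - X < t -> t <= X ->
  (Num.sqrt X)^-1 * (1 - t / X / 2 + 3 * (t / X) ^+ 2 / 8 - 5 * (t / X) ^+ 3 / 16)
  <= (Num.sqrt (X + t))^-1.
Proof.
move=> X0 tX tX'; set u := t / X.
have u1 : -1 < u by rewrite ltr_pdivlMr// mulN1r.
have u2 : u <= 1 by rewrite ler_pdivrMr// mul1r.
have -> : X + t = X * (1 + u) by rewrite /u; field; rewrite gt_eqF.
rewrite sqrtrM ?(ltW X0)// invfM; apply: ler_wpM2l; first by rewrite invr_ge0 sqrtr_ge0.
have u0 : 0 < 1 + u by lra.
set P := (X in X <= _); set q := Num.sqrt (1 + u).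
have q0 : 0 < q by rewrite sqrtr_gt0.
have qE : q ^+ 2 = 1 + u by rewrite sqr_sqrtr// ltW.
rewrite -(ler_pM2l q0) divff ?gt_eqF//.
rewrite leNgt; apply/negP => qP.
have : 1 < (q * P) ^+ 2 by rewrite expr2; nra.
rewrite exprMn qE.
(* The square is 1 plus [u^4] times a cubic that is negative for [-1 < u <= 1], so it cannot exceed
   1. *)
have -> : (1 + u) * P ^+ 2 =
  1 + u ^+ 4 * (- (35 / 64) + 14 / 64 * u - 35 / 256 * u ^+ 2 + 25 / 256 * u ^+ 3).
  by rewrite /P; field.
apply/negP; rewrite -leNgt gerDl; apply: mulr_ge0_le0.
  by rewrite (_ : u ^+ 4 = (u ^+ 2) ^+ 2) ?sqr_ge0// -exprM.
nra.
Qed.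

(** Odd powers of the coordinates cancel in pairs, and the terms of order [s^2 / X] cancel because
    the inverse distance is harmonic in dimension three. What is left is of order [(s^2 / X)^2]. *)
Lemma six_points_taylor (a b c s : R) :
  let X := a ^+ 2 + b ^+ 2 + c ^+ 2 in
  let P t := 1 - t / X / 2 + 3 * (t / X) ^+ 2 / 8 - 5 * (t / X) ^+ 3 / 16 in
  0 < X -> 16 * s ^+ 2 <= X ->
  6 - 6 * s ^+ 4 / X ^+ 2 <=
    P (2 * s * a + s ^+ 2) + P (2 * s * - a + s ^+ 2)
  + P (2 * s * b + s ^+ 2) + P (2 * s * - b + s ^+ 2)
  + P (2 * s * c + s ^+ 2) + P (2 * s * - c + s ^+ 2).
Proof.
move=> X P X0 sX.
have -> : P (2 * s * a + s ^+ 2) + P (2 * s * - a + s ^+ 2)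
  + P (2 * s * b + s ^+ 2) + P (2 * s * - b + s ^+ 2)
  + P (2 * s * c + s ^+ 2) + P (2 * s * - c + s ^+ 2)
  = 6 - (21 / 4) * (s ^+ 2 / X) ^+ 2 - (15 / 8) * (s ^+ 2 / X) ^+ 3.
  by rewrite /P /X; field; rewrite gt_eqF.
have -> : 6 * s ^+ 4 / X ^+ 2 = 6 * (s ^+ 2 / X) ^+ 2 by field; rewrite gt_eqF.
set t := s ^+ 2 / X.
have t0 : 0 <= t by rewrite divr_ge0 ?sqr_ge0// ltW.
have t1 : 16 * t <= 1 by rewrite mulrA ler_pdivrMr// mul1r.
have : 0 <= t ^+ 2 * (6 / 8 - 15 / 8 * t) by apply: mulr_ge0; [exact: sqr_ge0|lra].
rewrite exprS; nra.
Qed.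

(** Within distance [4 * s] the near kernel alone dominates the left side; beyond it the Taylor
    bound applies, with an error that is exactly the far kernel term. *)
Lemma six_points_kernel x y s : 0 < s ->
  6 / dist3 x y <= \sum_(p <- six_points x s) (dist3 p y)^-1
    + (6 * near_kernel x (4 * s) y + 6 * s ^+ 4 * far_kernel x (4 * s) y).
Proof.
move=> s0; rewrite /near_kernel /far_kernel; case: ifPn => [_|].
  rewrite mulr0 addr0 lerDr.
  by apply: sumr_ge0 => p _; rewrite invr_ge0 dist3_ge0.
rewrite -leNgt mulr0 add0r => sd.
have d0 : 0 < dist3 x y by apply: lt_le_trans sd; rewrite mulr_gt0.
rewrite /six_points !big_cons big_nil addr0.
pose a := x.1.1 - y.1.1; pose b := x.1.2 - y.1.2; pose c := x.2 - y.2.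
pose X := a ^+ 2 + b ^+ 2 + c ^+ 2.
have XE : X = dist3 x y ^+ 2 by rewrite dist3_sqr.
have X0 : 0 < X by rewrite XE exprn_gt0.
have sX : 16 * s ^+ 2 <= X.
  have -> : 16 * s ^+ 2 = (4 * s) ^+ 2 by ring.
  by rewrite XE ler_pXn2r// nnegrE ?dist3_ge0// mulr_ge0// ltW.
have dX : dist3 x y = Num.sqrt X by [].
pose P t := 1 - t / X / 2 + 3 * (t / X) ^+ 2 / 8 - 5 * (t / X) ^+ 3 / 16.
(* Here [r] is a coordinate of [x - y] up to sign. The squares of [4 * s - r] and [4 * s + r] bound
   [2 * s * |r|] by [X / 2], which puts the increment in the range of [inv_sqrt_taylor]. *)
have shift p r : r ^+ 2 <= X ->
    (p.1.1 - y.1.1) ^+ 2 + (p.1.2 - y.1.2) ^+ 2 + (p.2 - y.2) ^+ 2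
      = X + (2 * s * r + s ^+ 2) ->
    (dist3 x y)^-1 * P (2 * s * r + s ^+ 2) <= (dist3 p y)^-1.
  move=> rX pE; rewrite {2}/dist3 pE dX.
  have : 0 <= (4 * s - r) ^+ 2 by exact: sqr_ge0.
  have : 0 <= (4 * s + r) ^+ 2 by exact: sqr_ge0.
  by move=> r1 r2; apply: inv_sqrt_taylor => //; nra.
have aX : a ^+ 2 <= X by rewrite /X -addrA lerDl addr_ge0 ?sqr_ge0.
have bX : b ^+ 2 <= X by rewrite /X addrAC lerDr addr_ge0 ?sqr_ge0.
have cX : c ^+ 2 <= X by rewrite /X lerDr addr_ge0 ?sqr_ge0.
have aX' : (- a) ^+ 2 <= X by rewrite sqrrN.
have bX' : (- b) ^+ 2 <= X by rewrite sqrrN.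
have cX' : (- c) ^+ 2 <= X by rewrite sqrrN.
have i0 : 0 <= (dist3 x y)^-1 by rewrite invr_ge0 ltW.
have := ler_wpM2l i0 (six_points_taylor X0 sX).
have /(_ ltac:(rewrite /X /a /b /c /=; ring)) :=
  shift ((x.1.1 + s, x.1.2), x.2) _ aX.
have /(_ ltac:(rewrite /X /a /b /c /=; ring)) :=
  shift ((x.1.1 - s, x.1.2), x.2) _ aX'.
have /(_ ltac:(rewrite /X /a /b /c /=; ring)) :=
  shift ((x.1.1, x.1.2 + s), x.2) _ bX.
have /(_ ltac:(rewrite /X /a /b /c /=; ring)) :=
  shift ((x.1.1, x.1.2 - s), x.2) _ bX'.
have /(_ ltac:(rewrite /X /a /b /c /=; ring)) :=
  shift ((x.1.1, x.1.2), x.2 + s) _ cX.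
have /(_ ltac:(rewrite /X /a /b /c /=; ring)) :=
  shift ((x.1.1, x.1.2), x.2 - s) _ cX'.
rewrite -/X -![1 - _ / X / 2 + _ - _]/(P _).
have -> : 6 * s ^+ 4 * (dist3 x y)^-1 ^+ 5 = (dist3 x y)^-1 * (6 * s ^+ 4 / X ^+ 2).
  by rewrite XE; field; rewrite gt_eqF.
rewrite !mulrDr mulrN; lra.
Qed.

End SixPoints.

(** * Newtonian potentials: bounds, equicontinuity and second differences *)

Definition modulus (R : realType) (m eta e : R) : R :=
  Num.min (eta / 2) (e * eta ^+ 2 / (4 * (m + 1))).

Lemma modulus_gt0 (R : realType) (m eta e : R) :
  0 <= m -> 0 < eta -> 0 < e -> 0 < modulus m eta e.
Proof.
move=> m0 eta0 e0; have m1 : 0 < 4 * (m + 1) by lra.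
have h : 0 < e * eta ^+ 2 by rewrite mulr_gt0 ?exprn_gt0.
by rewrite lt_min divr_gt0//= divr_gt0.
Qed.

Section Potential.
Variables (R : realType) (D : set (pt R)) (g : pt R -> R).
Hypotheses (mD : measurable D) (mg : measurable_fun D g).
Hypothesis g0 : forall y, D y -> 0 <= g y.
Implicit Types (x : pt R) (u v : pt R -> R) (eta w m : R).

Local Notation "'I' u" := (\int[@leb3 R]_(y in D) (u y)%:E)%E (at level 10, u at level 9).

Let I_le u v : measurable_fun D u -> measurable_fun D v ->
  (forall y, D y -> 0 <= u y) -> (forall y, D y -> u y <= v y) -> (I u <= I v)%E.
Proof.
move=> mu mv u0 uv; apply: ge0_le_integral => //.
- exact/measurable_EFinP.
- exact/measurable_EFinP.
Qed.

Let I_add u v : measurable_fun D u -> measurable_fun D v ->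
  (forall y, D y -> 0 <= u y) -> (forall y, D y -> 0 <= v y) ->
  (I (fun y => (u y + v y)%R) = I u + I v)%E.
Proof.
move=> mu mv u0 v0; under eq_integral do rewrite EFinD.
by rewrite ge0_integralD//; exact/measurable_EFinP.
Qed.

Let I_scale (c : R) u : measurable_fun D u -> (forall y, D y -> 0 <= u y) -> 0 <= c ->
  (I (fun y => (c * u y)%R) = c%:E * I u)%E.
Proof.
move=> mu u0 c0; under eq_integral do rewrite EFinM.
by rewrite ge0_integralZl//; exact/measurable_EFinP.
Qed.

Let pot_measurable x : measurable_fun D (fun y => g y / dist3 x y).
Proof.
apply: measurable_funM => //.
by have := @measurable_dist3V R 1 D x; under eq_fun do rewrite expr1.
Qed.

Let pot_ge0 x y : D y -> 0 <= g y / dist3 x y.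
Proof. by move=> Dy; rewrite divr_ge0 ?g0 ?dist3_ge0. Qed.

Let near_measurable x eta : measurable_fun D (fun y => g y * near_kernel x eta y).
Proof. by apply: measurable_funM => //; exact: measurable_near_kernel. Qed.

Let near_ge0 x eta y : D y -> 0 <= g y * near_kernel x eta y.
Proof. by move=> Dy; rewrite mulr_ge0 ?g0 ?near_kernel_ge0. Qed.

(** Uniform smallness of the singular part of the potential. The estimates below see the density
    only through this bound and its mass, so they serve both bounded and square-integrable
    densities. *)
Definition near_bound eta w :=
  forall x, (I (fun y => (g y * near_kernel x eta y)%R) <= w%:E)%E.

Lemma newton_pot_ge0 x : 0 <= newton_pot D g x.
Proof.
by apply: fine_ge0; apply: integral_ge0 => y Dy; rewrite lee_fin pot_ge0.
Qed.

Section Mass.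
Variable m : R.
Hypothesis gm : (I g <= m%:E)%E.

Let m0 : 0 <= m.
Proof. by rewrite -lee_fin; apply: le_trans gm; apply: integral_ge0. Qed.

(** The kernel is split at distance [eta]; beyond it the inverse distance is at most [1 / eta]. *)
Let pot_le_ereal x eta w : 0 < eta -> near_bound eta w ->
  (I (fun y => (g y / dist3 x y)%R) <= (w + m / eta)%:E)%E.
Proof.
move=> e0 nb.
apply: (@le_trans _ _ (I (fun y => (g y * near_kernel x eta y + eta^-1 * g y)%R))%E).
  apply: (I_le (pot_measurable x) _ (@pot_ge0 x)).
    by apply: measurable_funD => //; exact: measurable_funM.
  move=> y Dy; rewrite /near_kernel; case: ifPn => [_|].
    by rewrite lerDl mulr_ge0 ?invr_ge0 ?(ltW e0)// g0.
  rewrite -leNgt mulr0 add0r mulrC => ed; apply: ler_wpM2r; first exact: g0.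
  by rewrite lef_pV2 ?posrE// (lt_le_trans e0).
have e0' : 0 <= eta^-1 by rewrite invr_ge0 ltW.
have mE : measurable_fun D (fun y => eta^-1 * g y) by exact: measurable_funM.
have eE y : D y -> 0 <= eta^-1 * g y by move=> Dy; rewrite mulr_ge0 ?g0.
rewrite (I_add (near_measurable x eta) mE (@near_ge0 x eta) eE) I_scale//.
rewrite (mulrC m) EFinD (EFinM eta^-1 m); apply: leeD => //.
by apply: lee_wpmul2l.
Qed.

(** [fine] would send an infinite integral to 0; finiteness is what makes [newton_pot] the true
    potential. *)
Lemma pot_fin x eta w : 0 < eta -> near_bound eta w ->
  I (fun y => (g y / dist3 x y)%R) = (newton_pot D g x)%:E.
Proof.
move=> e0 nb; rewrite /newton_pot fineK// ge0_fin_numE.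
  by apply: le_lt_trans (pot_le_ereal x e0 nb) _; rewrite ltry.
by apply: integral_ge0 => y Dy; rewrite lee_fin pot_ge0.
Qed.

Lemma newton_pot_le x eta w : 0 < eta -> near_bound eta w ->
  newton_pot D g x <= w + m / eta.
Proof. by move=> e0 nb; rewrite -lee_fin -(pot_fin x e0 nb); exact: pot_le_ereal. Qed.

(** Near [x] the whole kernel is charged to [w]. Elsewhere [y] is at distance at least [eta] from
    [x] and [eta / 2] from [x'], so the two inverse distances differ by at most
    [2 * dist3 x x' / eta^2]. *)
Lemma newton_pot_modulus x x' eta w : 0 < eta -> near_bound eta w ->
  dist3 x x' <= eta / 2 ->
  newton_pot D g x <= newton_pot D g x' + (w + 2 * m * dist3 x x' / eta ^+ 2).
Proof.
move=> e0 nb xx'; set c := 2 * dist3 x x' / eta ^+ 2.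
have c0 : 0 <= c by rewrite /c !mulr_ge0 ?invr_ge0 ?dist3_ge0 ?sqr_ge0.
rewrite -lee_fin !EFinD -!(pot_fin _ e0 nb).
apply: (@le_trans _ _ (I (fun y =>
   (g y / dist3 x' y + (g y * near_kernel x eta y + c * g y))%R))%E).
  apply: (I_le (pot_measurable x) _ (@pot_ge0 x)).
    by apply: measurable_funD => //; apply: measurable_funD => //; exact: measurable_funM.
  move=> y Dy; rewrite -subr_ge0.
  have -> : g y / dist3 x' y + (g y * near_kernel x eta y + c * g y) - g y / dist3 x y
    = g y * ((dist3 x' y)^-1 + near_kernel x eta y + c - (dist3 x y)^-1) by ring.
  apply: mulr_ge0; first exact: g0.
  have i0 : 0 <= (dist3 x' y)^-1 by rewrite invr_ge0 dist3_ge0.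
  rewrite /near_kernel; case: ifPn => [_|]; first by lra.
  rewrite -leNgt addr0 => ed.
  have t := dist3_triangle x' x y; have t' := dist3_triangle x x' y.
  have d1 : 0 < dist3 x y by lra.
  have d2 : 0 < dist3 x' y by lra.
  have -> : (dist3 x' y)^-1 + c - (dist3 x y)^-1 =
    (dist3 x y - dist3 x' y) / (dist3 x y * dist3 x' y) + c.
    by field; rewrite !gt_eqF.
  rewrite -[X in _ + X]opprK subr_ge0 lerNl -mulNr opprB ler_pdivrMr ?mulr_gt0//.
  apply: (@le_trans _ _ (dist3 x x')); first by rewrite (dist3C x x') in t' *; lra.
  have -> : c * (dist3 x y * dist3 x' y) =
     dist3 x x' * ((dist3 x y / eta) * (dist3 x' y / (eta / 2))).
    by rewrite /c; field; rewrite gt_eqF.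
  rewrite ler_peMr ?dist3_ge0// mulr_ege1//.
  - by rewrite ler_pdivlMr// mul1r.
  - by rewrite ler_pdivlMr ?divr_gt0// mul1r; lra.
have mE : measurable_fun D (fun y => c * g y) by exact: measurable_funM.
have eE y : D y -> 0 <= c * g y by move=> Dy; rewrite mulr_ge0 ?g0.
have mE' : measurable_fun D (fun y => g y * near_kernel x eta y + c * g y).
  exact: measurable_funD.
have eE' y : D y -> 0 <= g y * near_kernel x eta y + c * g y.
  by move=> Dy; rewrite addr_ge0 ?near_ge0 ?eE.
rewrite (I_add (pot_measurable x') mE' (@pot_ge0 x') eE').
rewrite (I_add (near_measurable x eta) mE (@near_ge0 x eta) eE).
apply: leeD => //; apply: leeD => //; rewrite I_scale//.
have -> : 2 * m * dist3 x x' / eta ^+ 2 = c * m by rewrite /c; ring.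
by rewrite (EFinM c m); apply: lee_wpmul2l.
Qed.

(** The first entry of [modulus] meets the distance condition of [newton_pot_modulus], the second
    makes its mass term at most [e / 2]; [m + 1] keeps the denominator positive when [m = 0]. The
    modulus is the same for all densities sharing [m] and [eta]. *)
Lemma newton_pot_equicontinuous x x' eta e : 0 < eta -> 0 < e ->
  near_bound eta (e / 2) -> dist3 x x' <= modulus m eta e ->
  newton_pot D g x <= newton_pot D g x' + e.
Proof.
move=> eta0 e0 nb; rewrite le_min => /andP[x1 x2].
apply: le_trans (newton_pot_modulus eta0 nb x1) _; rewrite lerD2l.
have m1 : 0 < m + 1 by have := m0; lra.
have h : 4 * (m + 1) * dist3 x x' <= e * eta ^+ 2.
  by rewrite mulrC -ler_pdivlMr// mulr_gt0.
have : 2 * m * dist3 x x' / eta ^+ 2 <= e / 2.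
  by rewrite ler_pdivrMr ?exprn_gt0//; have := dist3_ge0 x x'; nra.
lra.
Qed.

Lemma newton_pot_continuous :
  (forall e, 0 < e -> exists2 eta, 0 < eta & near_bound eta e) ->
  continuous (newton_pot D g).
Proof.
move=> nb; apply: continuous_ptP => x e e0.
have e2 : 0 < e / 2 by rewrite divr_gt0.
have [|eta eta0 nbe] := nb (e / 2 / 2); first by rewrite divr_gt0.
have d0 : 0 < modulus m eta (e / 2) by apply: modulus_gt0 => //; exact: m0.
exists (modulus m eta (e / 2) / 3) => [|y]; first by rewrite divr_gt0.
move=> /dist3_lt_ball; rewrite mulrC divfK// => /ltW xy.
have h1 := newton_pot_equicontinuous eta0 e2 nbe xy.
have yx : dist3 y x <= modulus m eta (e / 2) by rewrite dist3C.
have h2 := newton_pot_equicontinuous eta0 e2 nbe yx.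
rewrite ltr_norml; apply/andP; split; lra.
Qed.

(** Integrates [six_points_kernel] against [g]; [near_bound] supplies finiteness of the
    potentials. *)
Lemma newton_pot_six_points x s eta w (c : R) : 0 < s -> 0 < eta -> near_bound eta w ->
  (I (fun y => (g y * (6 * near_kernel x (4 * s) y + 6 * s ^+ 4 * far_kernel x (4 * s) y))%R)
     <= c%:E)%E ->
  6 * newton_pot D g x <= \sum_(p <- six_points x s) newton_pot D g p + c.
Proof.
move=> s0 e0 nb ic.
have s4 : 0 <= 6 * s ^+ 4 by rewrite mulr_ge0// exprn_ge0// ltW.
have mk : measurable_fun D (fun y => g y *
    (6 * near_kernel x (4 * s) y + 6 * s ^+ 4 * far_kernel x (4 * s) y)).
  apply: measurable_funM => //; apply: measurable_funD; apply: measurable_funM => //.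
  - exact: measurable_near_kernel.
  - exact: measurable_far_kernel.
have k0 y : D y -> 0 <= g y *
    (6 * near_kernel x (4 * s) y + 6 * s ^+ 4 * far_kernel x (4 * s) y).
  by move=> Dy; rewrite mulr_ge0 ?g0// addr_ge0// mulr_ge0// ?near_kernel_ge0 ?far_kernel_ge0.
have ms : measurable_fun D (fun y => \sum_(p <- six_points x s) (g y / dist3 p y)).
  exact: measurable_sum.
have s0' y : D y -> 0 <= \sum_(p <- six_points x s) (g y / dist3 p y).
  by move=> Dy; apply: sumr_ge0 => p _; exact: pot_ge0.
rewrite -lee_fin EFinM -(pot_fin _ e0 nb) -I_scale//; last by move=> y; exact: pot_ge0.
apply: (@le_trans _ _ (I (fun y => (\sum_(p <- six_points x s) (g y / dist3 p y) +
  g y * (6 * near_kernel x (4 * s) y + 6 * s ^+ 4 * far_kernel x (4 * s) y))%R))%E).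
  apply: I_le.
  - exact: measurable_funM.
  - exact: measurable_funD.
  - by move=> y Dy; rewrite mulr_ge0// pot_ge0.
  - move=> y Dy; rewrite -mulr_sumr -mulrDr mulrCA ler_wpM2l ?g0//.
    exact: six_points_kernel.
rewrite I_add// EFinD leeD//.
under eq_integral do rewrite -sumEFin.
rewrite ge0_integral_sum//; last by move=> p; exact/measurable_EFinP.
rewrite -sumEFin le_eqVlt; apply/orP; left; apply/eqP.
by apply: eq_bigr => p _; rewrite (pot_fin _ e0 nb).
Qed.

(* When the density stays at distance at least 1, only the far part of the kernel
   contributes. *)
Lemma six_points_error_far x s : 0 < s -> 4 * s <= 1 -> (forall y, D y -> 1 <= dist3 x y) ->
  (I (fun y => (g y * (6 * near_kernel x (4 * s) y + 6 * s ^+ 4 * far_kernel x (4 * s) y))%R)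
     <= (6 * m * s ^+ 4)%:E)%E.
Proof.
move=> s0 s1 far.
have s4 : 0 <= 6 * s ^+ 4 by rewrite mulr_ge0// exprn_ge0// ltW.
apply: (@le_trans _ _ (I (fun y => (6 * s ^+ 4 * g y)%R))%E).
  apply: I_le.
  - apply: measurable_funM => //; apply: measurable_funD; apply: measurable_funM => //.
    + exact: measurable_near_kernel.
    + exact: measurable_far_kernel.
  - exact: measurable_funM.
  - by move=> y Dy; rewrite mulr_ge0 ?g0// addr_ge0// mulr_ge0// ?near_kernel_ge0 ?far_kernel_ge0.
  - move=> y Dy; rewrite [leRHS]mulrC ler_wpM2l ?g0//.
    have d1 := far y Dy.
    rewrite /near_kernel /far_kernel ltNge (le_trans s1 d1)/= mulr0 add0r.
    rewrite ler_piMr// exprn_ile1 ?invr_ge0 ?dist3_ge0//.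
    by rewrite invf_le1// (lt_le_trans _ d1).
rewrite I_scale// (_ : 6 * m * s ^+ 4 = 6 * s ^+ 4 * m); last by ring.
by rewrite (EFinM (6 * s ^+ 4) m); apply: lee_wpmul2l.
Qed.

End Mass.

Lemma near_boundS eta w w' : w <= w' -> near_bound eta w -> near_bound eta w'.
Proof. by move=> ww' nb x; apply: le_trans (nb x) _; rewrite lee_fin. Qed.

Section Bounded.
Variable S : R.
Hypotheses (S0 : 0 <= S) (gS : forall y, D y -> g y <= S).

Lemma near_bound_bounded eta : 0 < eta -> near_bound eta (64 * S * eta ^+ 2).
Proof.
move=> e0 x.
apply: (@le_trans _ _ (I (fun y => (S * near_kernel x eta y)%R))%E).
  apply: (I_le (near_measurable x eta) _ (@near_ge0 x eta)).
    by apply: measurable_funM => //; exact: measurable_near_kernel.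
  by move=> y Dy; apply: ler_wpM2r; rewrite ?near_kernel_ge0 ?gS.
rewrite I_scale//; last 2 first.
- exact: measurable_near_kernel.
- by move=> y _; exact: near_kernel_ge0.
rewrite (_ : 64 * S * eta ^+ 2 = S * (64 * eta ^+ 2)); last by ring.
by rewrite EFinM lee_wpmul2l ?lee_fin// integral_near_kernel.
Qed.

(** The cap 1 gives [eta^2 <= eta], after which the second entry brings [64 * S * eta^2] below
    [e]. *)
Definition eta_bounded e := Num.min 1 (e / (64 * (S + 1))).

Lemma eta_bounded_gt0 e : 0 < e -> 0 < eta_bounded e.
Proof.
by move=> e0; rewrite lt_min ltr01/= divr_gt0// mulr_gt0//; have := S0; lra.
Qed.

Lemma near_bound_bounded_small e : 0 < e -> near_bound (eta_bounded e) e.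
Proof.
move=> e0; have h0 := eta_bounded_gt0 e0.
apply: near_boundS (near_bound_bounded h0).
have h1 : eta_bounded e <= 1 by rewrite ge_min lexx.
have : eta_bounded e <= e / (64 * (S + 1)) by rewrite ge_min lexx orbT.
rewrite ler_pdivlMr; last by have := S0; lra.
move: (eta_bounded e) h0 h1 => h h0 h1; have := S0; nra.
Qed.

(** Both kernels contribute at order [s^2], the order of a Laplacian:
    [7680 = 6 * 64 * 16 + 6 * 4096 / 16]. *)
Lemma six_points_error_bounded x s : 0 < s ->
  (I (fun y => (g y * (6 * near_kernel x (4 * s) y + 6 * s ^+ 4 * far_kernel x (4 * s) y))%R)
     <= (7680 * S * s ^+ 2)%:E)%E.
Proof.
move=> s0.
have s40 : 0 < 4 * s by rewrite mulr_gt0.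
have s4 : 0 <= 6 * s ^+ 4 by rewrite mulr_ge0// exprn_ge0// ltW.
have mn : measurable_fun D (fun y => S * 6 * near_kernel x (4 * s) y).
  by apply: measurable_funM => //; exact: measurable_near_kernel.
have mf : measurable_fun D (fun y => S * (6 * s ^+ 4) * far_kernel x (4 * s) y).
  by apply: measurable_funM => //; exact: measurable_far_kernel.
have c1 : 0 <= S * 6 by rewrite mulr_ge0.
have c2 : 0 <= S * (6 * s ^+ 4) by rewrite mulr_ge0.
apply: (@le_trans _ _ (I (fun y => (S * 6 * near_kernel x (4 * s) y
    + S * (6 * s ^+ 4) * far_kernel x (4 * s) y)%R))%E).
  apply: I_le.
  - apply: measurable_funM => //; apply: measurable_funD; apply: measurable_funM => //.
    + exact: measurable_near_kernel.
    + exact: measurable_far_kernel.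
  - exact: measurable_funD.
  - by move=> y Dy; rewrite mulr_ge0 ?g0// addr_ge0// mulr_ge0// ?near_kernel_ge0 ?far_kernel_ge0.
  - move=> y Dy; rewrite -!(mulrA S) -mulrDr ler_wpM2r ?gS//.
    by rewrite addr_ge0// mulr_ge0// ?near_kernel_ge0 ?far_kernel_ge0.
have n0 y : D y -> 0 <= near_kernel x (4 * s) y by move=> _; exact: near_kernel_ge0.
have f0 y : D y -> 0 <= far_kernel x (4 * s) y by move=> _; exact: far_kernel_ge0.
rewrite (I_add mn mf); [|by move=> y Dy; rewrite mulr_ge0 ?n0|
  by move=> y Dy; rewrite mulr_ge0 ?f0].
rewrite (I_scale (@measurable_near_kernel R D x _) n0 c1).
rewrite (I_scale (@measurable_far_kernel R D x _) f0 c2).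
have -> : 7680 * S * s ^+ 2 = S * 6 * (64 * (4 * s) ^+ 2)
  + S * (6 * s ^+ 4) * (4096 / (4 * s) ^+ 2) by field; rewrite gt_eqF.
rewrite EFinD !(EFinM (S * _)) leeD//; apply: lee_wpmul2l; rewrite ?lee_fin//.
- exact: integral_near_kernel.
- exact: integral_far_kernel.
Qed.

End Bounded.

Section SquareIntegrable.
Variable Q : R.
Hypothesis gQ : (I (fun y => (g y ^+ 2)%R) <= Q%:E)%E.

(* AM-GM: g k <= t g^2 + k^2 / t *)
Lemma near_bound_sqr eta t : 0 < eta -> 0 < t ->
  near_bound eta (t * Q + 64 * eta / t).
Proof.
move=> e0 t0 x.
have mk := @measurable_near_kernel R D x eta.
have m1 : measurable_fun D (fun y => t * g y ^+ 2).
  by apply: measurable_funM => //; exact: measurable_funX.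
have m2 : measurable_fun D (fun y => t^-1 * near_kernel x eta y ^+ 2).
  by apply: measurable_funM => //; exact: measurable_funX.
have t0' : 0 < t^-1 by rewrite invr_gt0.
apply: (@le_trans _ _ (I (fun y => (t * g y ^+ 2 + t^-1 * near_kernel x eta y ^+ 2)%R))%E).
  apply: (I_le (near_measurable x eta) _ (@near_ge0 x eta)); first exact: measurable_funD.
  move=> y Dy; set k := near_kernel x eta y; rewrite -subr_ge0.
  have -> : t * g y ^+ 2 + t^-1 * k ^+ 2 - g y * k =
    t * (g y - k / t / 2) ^+ 2 + t^-1 * k ^+ 2 * (3 / 4) by field; rewrite gt_eqF.
  have := mulr_ge0 (ltW t0) (sqr_ge0 (g y - k / t / 2)).
  have := mulr_ge0 (ltW t0') (sqr_ge0 k); lra.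
have g2 y : D y -> 0 <= g y ^+ 2 by move=> _; exact: sqr_ge0.
have k2 y : D y -> 0 <= near_kernel x eta y ^+ 2 by move=> _; exact: sqr_ge0.
rewrite (I_add m1 m2); [|by move=> y Dy; rewrite mulr_ge0 ?g2 ?ltW|
  by move=> y Dy; rewrite mulr_ge0 ?k2 ?ltW].
rewrite (I_scale (measurable_funX 2 mg) g2 (ltW t0)).
rewrite (I_scale (measurable_funX 2 mk) k2 (ltW t0')).
rewrite (_ : 64 * eta / t = t^-1 * (64 * eta)); last by ring.
rewrite EFinD !EFinM leeD//; apply: lee_wpmul2l; rewrite ?lee_fin ?(ltW t0) ?(ltW t0')//.
by rewrite -EFinM integral_near_kernel_sqr.
Qed.

Lemma near_bound_sqr_small e : 0 < e -> exists2 eta, 0 < eta & near_bound eta e.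
Proof.
move=> e0.
have Q0 : 0 <= Q.
  rewrite -lee_fin; apply: le_trans gQ; apply: integral_ge0 => y _.
  by rewrite lee_fin sqr_ge0.
(* This makes [t * Q] at most [e / 2]; [eta] is then chosen so that the other term equals
   [e / 2]. *)
pose t := e / (2 * (Q + 1)).
have t0 : 0 < t by rewrite divr_gt0// mulr_gt0//; lra.
have h0 : 0 < e * t / 128 by rewrite divr_gt0// mulr_gt0.
exists (e * t / 128) => //; apply: near_boundS (near_bound_sqr h0 t0).
have -> : 64 * (e * t / 128) / t = e / 2 by field; rewrite gt_eqF.
have : t * (2 * (Q + 1)) = e by rewrite /t divfK// gt_eqF// mulr_gt0//; lra.
lra.
Qed.

End SquareIntegrable.

End Potential.

(** * Cube roots *)

Section CubeRoot.
Variable R : realType.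
Implicit Types s t : R.

(** Turns the exponent [4/3] of (F2) into a fourth power, so that the estimates become
    polynomial. *)
Definition croot t : R := t `^ (3^-1).

Lemma croot_ge0 t : 0 <= croot t. Proof. exact: powR_ge0. Qed.

Lemma croot_gt0 t : 0 < t -> 0 < croot t. Proof. exact: powR_gt0. Qed.

Lemma crootK t : 0 <= t -> croot t ^+ 3 = t.
Proof.
move=> t0; rewrite -powR_mulrn ?croot_ge0// /croot -powRrM.
by rewrite mulVf// powRr1.
Qed.

Lemma croot_powR t : t `^ (4 / 3) = croot t ^+ 4.
Proof. by rewrite -powR_mulrn ?croot_ge0// /croot -powRrM mulrC. Qed.

Lemma le_croot (c t : R) : 0 <= c -> 0 <= t -> (c <= croot t) = (c ^+ 3 <= t).
Proof.
by move=> c0 t0; rewrite -{2}(crootK t0) ler_pXn2r// nnegrE croot_ge0.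
Qed.

Lemma croot_le (c t : R) : 0 <= c -> 0 <= t -> (croot t <= c) = (t <= c ^+ 3).
Proof.
by move=> c0 t0; rewrite -{2}(crootK t0) ler_pXn2r// nnegrE croot_ge0.
Qed.

End CubeRoot.

(** * Growth of [f] and of [Aprime f] at small and large densities *)

Section EquationOfState.
Variables (R : realType) (f : R -> R).
Hypothesis f1 : F1 f.
Implicit Types s t delta : R.

Lemma f_gt0 s : 0 < s -> 0 < f s.
Proof.
move=> s0; have [f0 [_ fi]] := f1.
have h : 0 < s / 2 by rewrite divr_gt0.
by apply: le_lt_trans (f0 _ (ltW h)) (fi _ _ h _); lra.
Qed.

Lemma f_le s t : 0 < s -> s <= t -> f s <= f t.
Proof.
move=> s0; rewrite le_eqVlt => /orP[/eqP->//|st]; have [_ [_ fi]] := f1.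
by apply/ltW/fi.
Qed.

Lemma measurable_pressure s :
  measurable_fun (`]0, s] : set R) (fun t => f t / t ^+ 2).
Proof.
have [_ [cf _]] := f1; apply: measurable_funM.
  apply: (@measurable_funS _ _ _ _ (`[0%R, +oo[%classic : set R)
    (`]0%R, s]%classic : set R) f) => //.
    by move=> t /=; rewrite !in_itv/= => /andP[/ltW-> _].
  exact: subspace_continuous_measurable_fun.
apply: (@eq_measurable_fun _ _ _ _ _ (fun t => t `^ (- 1) ^+ 2)).
  move=> t; rewrite inE/= in_itv/= => /andP[t0 _].
  by rewrite powR_inv1 ?(ltW t0)// exprVn.
by apply: measurable_funX; apply: measurable_funTS; exact: measurable_powR.
Qed.

(** The integrand is at most [delta / croot t^2]. With ratio 8 the cube root halves at each scale,
    so values grow like [4^k] while lengths shrink like [8^-k]. *)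
Lemma integral_pressure_le delta s : 0 < s -> 0 <= delta ->
  (forall t, 0 < t -> t <= s -> f t <= delta * croot t ^+ 4) ->
  (\int[@lebesgue_measure R]_(t in `]0%R, s]) (f t / t ^+ 2)%:E
    <= (2 * (8 * delta * croot s))%:E)%E.
Proof.
move=> s0 d0 fd.
have p0 k : 0 < 2 ^+ k :> R by rewrite exprn_gt0.
have q0 k : 0 < 8 ^+ k :> R by rewrite exprn_gt0.
have c0 := croot_gt0 s0.
have q8 k : 8 ^+ k = (2 ^+ k) ^+ 3 :> R.
  by rewrite -exprM mulnC exprM; congr (_ ^+ _); ring.
apply: (@dyadic_integral_le _ (measurableTypeR R) R (@lebesgue_measure R) _ _
  (fun k => `]0, (8 * s / 8 ^+ k)]%classic)
  (fun k => delta * (2 ^+ k / croot s) ^+ 2)) => //.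
- exact: measurable_pressure.
- move=> t; rewrite /= in_itv/= => /andP[t0 _].
  by rewrite divr_ge0 ?sqr_ge0// ltW// f_gt0.
- by move=> k; rewrite mulr_ge0 ?sqr_ge0.
- move=> t; rewrite /= in_itv/= => /andP[t0 ts] _.
  (* [geometric_scale] needs a strict upper bound; starting at [8 * s] also covers the endpoint
     [t = s]. *)
  have t8 : t < 8 * s by lra.
  have [k /andP[k1 k2]] := geometric_scale (ltr1n R 8) t0 t8.
  exists k; first by rewrite /= in_itv/= t0 ltW.
  have ct0 := croot_gt0 t0.
  have ck : croot s / 2 ^+ k <= croot t.
    rewrite le_croot ?(ltW t0)//; last by rewrite divr_ge0// ltW.
    rewrite expr_div_n crootK ?(ltW s0)// -q8; apply: le_trans k1.
    by rewrite exprS invfM mulrA (mulrC 8) mulfK.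
  apply: (@le_trans _ _ (delta * (croot t)^-1 ^+ 2)).
    rewrite ler_pdivrMr ?exprn_gt0//; apply: le_trans (fd t t0 ts) _.
    rewrite -{3}(crootK (ltW t0)) le_eqVlt; apply/orP; left; apply/eqP.
    by field; rewrite gt_eqF.
  rewrite ler_wpM2l// ler_pXn2r ?nnegrE ?invr_ge0 ?(ltW ct0)//; last first.
    by rewrite divr_ge0// ltW.
  by rewrite -[leRHS]invrK lef_pV2 ?posrE ?invr_gt0 ?divr_gt0// invf_div.
- move=> k; have z0 : 0 < 8 * s / 8 ^+ k by rewrite divr_gt0// mulr_gt0.
  rewrite /= lebesgue_measure_itv/= lte_fin z0 sube0 -EFinM lee_fin.
  rewrite q8 -{2}(crootK (ltW s0)) le_eqVlt; apply/orP; left; apply/eqP.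
  by field; rewrite !gt_eqF.
Qed.

Lemma Aprime_le delta s : 0 < s -> 0 <= delta ->
  (forall t, 0 < t -> t <= s -> f t <= delta * croot t ^+ 4) ->
  Aprime f s <= 17 * delta * croot s.
Proof.
move=> s0 d0 fd; have c0 := croot_gt0 s0.
have h1 : f s / s <= delta * croot s.
  rewrite ler_pdivrMr//; apply: le_trans (fd s s0 (lexx s)) _.
  by rewrite -{3}(crootK (ltW s0)) le_eqVlt; apply/orP; left; apply/eqP; ring.
have h2 : fine (\int[@lebesgue_measure R]_(t in `]0%R, s]) (f t / t ^+ 2)%:E)
    <= 2 * (8 * delta * croot s).
  have ile := integral_pressure_le s0 d0 fd.
  rewrite -lee_fin fineK// ge0_fin_numE; first by apply: le_lt_trans ile _; rewrite ltry.
  apply: integral_ge0 => t; rewrite /= in_itv/= => /andP[t0 _].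
  by rewrite lee_fin divr_ge0 ?sqr_ge0// ltW// f_gt0.
rewrite /Aprime; lra.
Qed.

Lemma Aprime_ge s : 0 < s -> f s / s <= Aprime f s.
Proof.
move=> s0; rewrite /Aprime lerDr; apply/fine_ge0/integral_ge0 => t.
rewrite /= in_itv/= => /andP[t0 _].
by rewrite lee_fin divr_ge0 ?sqr_ge0// ltW// f_gt0.
Qed.

Hypothesis f2 : F2 f.

Lemma F2_near0 : exists2 s, 0 < s & forall t, 0 < t -> t <= s -> f t <= croot t ^+ 4.
Proof.
have [/cvgrPdist_lt/(_ 1 ltr01) [e /= e0 he] _] := f2.
exists (e / 2) => [|t t0 te]; first by rewrite divr_gt0.
have te' : `|0 - t| < e by rewrite sub0r normrN gtr0_norm//; lra.
have := he t te' t0.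
rewrite sub0r normrN powRN croot_powR => /(le_lt_trans (ler_norm _)).
by rewrite ltr_pdivrMr ?exprn_gt0 ?croot_gt0// mul1r => /ltW.
Qed.

Lemma F2_nearoo (N : R) : exists2 s, 0 < s & forall t, s <= t -> N * croot t ^+ 4 <= f t.
Proof.
have [_ /cvgryPge/(_ N) [a [_ ha]]] := f2.
exists (Num.max a 0 + 1) => [|t st].
  by rewrite ltr_wpDl// le_max lexx orbT.
have m1 : a <= Num.max a 0 by rewrite le_max lexx.
have m2 : 0 <= Num.max a 0 by rewrite le_max lexx orbT.
have t0 : 0 < t by lra.
have /= := ha t ltac:(lra).
by rewrite powRN croot_powR ler_pdivlMr// exprn_gt0// croot_gt0.
Qed.

(** (F2) covers small [t]; on the remaining bounded range [f] is bounded by monotonicity and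
    [croot t] stays away from 0. *)
Lemma pressure_growth (C : R) : exists2 delta, 0 <= delta &
  forall t, 0 < t -> t <= C -> f t <= delta * croot t ^+ 4.
Proof.
have [s s0 hs] := F2_near0.
have cs := croot_gt0 s0; have c4 : 0 < croot s ^+ 4 by rewrite exprn_gt0.
pose b := Num.max C s; pose c := f b / croot s ^+ 4.
have sb : s <= b by rewrite le_max lexx orbT.
have c0 : 0 <= c by rewrite divr_ge0 ?ltW// f_gt0// (lt_le_trans s0).
exists (1 + c) => [|t t0 tC]; first by rewrite addr_ge0.
have ct : 0 <= croot t ^+ 4 by rewrite exprn_ge0// croot_ge0.
have [ts|ts] := leP t s.
  by apply: le_trans (hs t t0 ts) _; rewrite mulrDl mul1r lerDl mulr_ge0.
apply: (@le_trans _ _ (c * croot t ^+ 4)); last by rewrite mulrDl mul1r lerDr.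
have tb : t <= b by rewrite le_max tC.
apply: le_trans (f_le t0 tb) _.
rewrite /c -mulrAC ler_pdivlMr// ler_wpM2l//.
  by apply/ltW/f_gt0/(lt_le_trans t0).
rewrite ler_pXn2r ?nnegrE ?croot_ge0// le_croot ?croot_ge0 ?(ltW t0)//.
by rewrite crootK ltW.
Qed.

Lemma Aprime_bounded (C : R) :
  exists2 a, 0 < a & forall s, 0 < s -> s <= C -> Aprime f s <= a.
Proof.
have [delta d0 hd] := pressure_growth C.
exists (17 * delta * croot C + 1) => [|s s0 sC].
  by rewrite ltr_wpDl// !mulr_ge0 ?croot_ge0.
have := Aprime_le s0 d0 (fun t ht hts => hd t ht (le_trans hts sC)).
have : croot s <= croot C.
  by rewrite le_croot ?croot_ge0 ?crootK ?(ltW s0)// (le_trans (ltW s0) sC).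
have := croot_ge0 s; nra.
Qed.

Lemma Aprime_small (e : R) : 0 < e ->
  exists2 s0, 0 < s0 & forall s, 0 < s -> s < s0 -> Aprime f s < e.
Proof.
move=> e0; have [s1 s10 h1] := F2_near0.
have e3 : 0 < e / 18 by rewrite divr_gt0.
exists (Num.min s1 ((e / 18) ^+ 3)) => [|s s0]; first by rewrite lt_min s10 exprn_gt0.
rewrite lt_min => /andP[ss1 se].
have := @Aprime_le 1 s s0 ler01 (fun t ht hts =>
  ltac:(rewrite mul1r; exact: (h1 t ht (le_trans hts (ltW ss1))))).
have : croot s <= e / 18 by rewrite croot_le ?(ltW e3) ?(ltW s0)// ltW.
lra.
Qed.

(** The term [f s / s] alone suffices, by (F2) at infinity. *)
Lemma Aprime_superlinear (N : R) :
  exists2 s0, 0 < s0 & forall s, s0 <= s -> N * croot s <= Aprime f s.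
Proof.
have [s0 s00 h] := F2_nearoo N; exists s0 => // s ss.
have sp : 0 < s by exact: lt_le_trans ss.
apply: le_trans (Aprime_ge sp); rewrite ler_pdivlMr//; apply: le_trans (h s ss).
rewrite -{2}(crootK (ltW sp)) le_eqVlt; apply/orP; left; apply/eqP; ring.
Qed.

End EquationOfState.

(** * Integrability of powers of an [L^q] density on a bounded domain *)

Definition origin {R : realType} : pt R := ((0, 0), 0).

Section Lq.
Variables (R : realType) (K : set (pt R)) (q C : R) (g : pt R -> R).
Hypotheses (oK : open K) (Kb : forall p, K p -> enorm3 p <= C).
Hypotheses (gq : in_Lq q K g) (g0 : forall y, K y -> 0 <= g y).

Lemma coord_le_enorm3 (p : pt R) :
  [/\ `|p.1.1| <= enorm3 p, `|p.1.2| <= enorm3 p & `|p.2| <= enorm3 p].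
Proof.
have := coord_le_dist3 p origin.
by rewrite /dist3 /origin /= !subr0.
Qed.

Lemma bounded_leb3_lty : (leb3 K < +oo)%E.
Proof.
have C1 : 0 <= `|C| + 1 by rewrite addr_ge0.
have KB : K `<=` ball origin (`|C| + 1).
  move=> p Kp; have [h1 h2 h3] := coord_le_enorm3 p.
  have hC := le_trans (Kb Kp) (ler_norm C).
  by apply/ball_pt; rewrite /origin /= !sub0r !normrN; split; lra.
have : (leb3 K <= leb3 (ball origin (`|C| + 1)))%E.
  apply: (@le_measure _ _ _ (@leb3 R)) => //; rewrite inE.
    exact: open_pt_measurable.
  exact: measurable_ball_pt.
by move=> /le_lt_trans; apply; rewrite leb3_ball// ltry.
Qed.

Lemma expr_le_powR (r : R) n : 0 <= r -> n%:R <= q -> r ^+ n <= 1 + `|r| `^ q.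
Proof.
move=> r0 nq; rewrite ger0_norm//; have [r1|r1] := leP r 1.
  by rewrite (le_trans (exprn_ile1 _ r0 r1))// lerDl powR_ge0.
apply: (@le_trans _ _ (r `^ q)); last by rewrite lerDr.
by rewrite -powR_mulrn// ler_powR// ltW.
Qed.

(** Applied with [n = 1] for the mass and [n = 2] for [near_bound_sqr]; the dominating function
    [1 + |g|^q] is integrable because [K] has finite volume. *)
Lemma integral_expr_Lq n : n%:R <= q ->
  exists Q, (\int[@leb3 R]_(y in K) (g y ^+ n)%:E <= Q%:E)%E.
Proof.
move=> nq; have [mg gfin] := gq; have mK := open_pt_measurable oK.
have mp : measurable_fun K (fun y => `|g y| `^ q).
  apply: (measurableT_comp (measurable_powR q)).
  exact: (measurableT_comp (@normr_measurable R setT)).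
have : (\int[@leb3 R]_(y in K) (g y ^+ n)%:E < +oo)%E.
  apply: (@le_lt_trans _ _ (\int[@leb3 R]_(y in K) (1 + (`|g y| `^ q)%:E))%E).
    apply: ge0_le_integral => //.
    - by move=> y Ky; rewrite lee_fin exprn_ge0// g0.
    - by apply/measurable_EFinP; exact: measurable_funX.
    - by apply: emeasurable_funD => //; exact/measurable_EFinP.
    - by move=> y Ky; rewrite -EFinD lee_fin expr_le_powR// g0.
  rewrite ge0_integralD//; last first.
    exact/measurable_EFinP.
  rewrite integral_cst// mul1e; apply: lte_add_pinfty => //.
  exact: bounded_leb3_lty.
set J := integral _ _ _ => Jfin; exists (fine J); rewrite fineK// ge0_fin_numE//.
by apply: integral_ge0 => y Ky; rewrite lee_fin exprn_ge0// g0.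
Qed.

End Lq.

(** * Contradiction along an outward radial ray *)

Section Ray.
Variables (R : realType) (f : R -> R) (K : set (pt R)).
Hypotheses (f1 : F1 f) (f2 : F2 f) (nt : no_trapping K).

Definition ray (p : pt R) (t : R) : pt R :=
  ((p.1.1 + t * p.1.1, p.1.2 + t * p.1.2), p.2).

Lemma ray_notin p t : ~ K p -> 0 <= t -> ~ K (ray p t).
Proof. by move=> Kp t0; exact: nt. Qed.

Lemma rcyl_sqr (p : pt R) : rcyl p ^+ 2 = p.1.1 ^+ 2 + p.1.2 ^+ 2.
Proof. by rewrite sqr_sqrtr// addr_ge0// sqr_ge0. Qed.

Lemma rcyl_ray p t : rcyl (ray p t) ^+ 2 = (1 + t) ^+ 2 * rcyl p ^+ 2.
Proof. by rewrite !rcyl_sqr /ray /=; ring. Qed.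

Lemma dist3_ray p t : 0 <= t -> dist3 p (ray p t) = t * rcyl p.
Proof.
move=> t0; rewrite /dist3 /rcyl /= -[t in RHS](ger0_norm t0) -sqrtr_sqr -sqrtrM ?sqr_ge0//.
by congr Num.sqrt; ring.
Qed.

Variables (rho W : pt R -> R) (Om lam C : R).
Hypotheses (rho_cont : {within ~` K, continuous rho})
  (rho_bound : forall x, ~ K x -> `|rho x| <= C)
  (W0 : forall x, 0 <= W x) (Om0 : 0 < Om)
  (rho_eq : forall x, ~ K x -> 0 < rho x ->
    Aprime f (rho x) = W x + Om ^+ 2 * rcyl x ^+ 2 / 2 + lam).

(** The absolute value keeps the ray outside [K] for every real parameter, so continuity holds on
    the whole line. *)
Lemma ray_continuous p : ~ K p -> continuous (fun t : R => rho (ray p `|t|)).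
Proof.
move=> Kp t; apply/cvgrPdist_lt => e e0.
have [d d0 hd] := within_ptP rho_cont (ray_notin Kp (normr_ge0 t)) e0.
pose b := 1 + `|p.1.1| + `|p.1.2|.
have b0 : 0 < b by rewrite /b; have := normr_ge0 p.1.1; have := normr_ge0 p.1.2; lra.
have db : 0 < d / b by rewrite divr_gt0.
suff : nbhs t [set t' | `|rho (ray p `|t|) - rho (ray p `|t'|)| < e] by [].
apply/nbhs_ballP; exists (d / b) => //= t' tt'; apply: hd.
  exact: (ray_notin Kp (normr_ge0 t')).
have tt : `| `|t| - `|t'| | < d / b by exact: le_lt_trans (ler_dist_dist _ _) tt'.
have hb (c : R) : `|c| <= b -> `|c + `|t| * c - (c + `|t'| * c)| < d.
  move=> cb; have -> : c + `|t| * c - (c + `|t'| * c) = (`|t| - `|t'|) * c by ring.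
  rewrite normrM; apply: le_lt_trans (ler_wpM2l (normr_ge0 _) cb) _.
  by rewrite -ltr_pdivlMr.
have n1 := normr_ge0 p.1.1; have n2 := normr_ge0 p.1.2.
apply/ball_pt; split => /=.
- by apply: hb; rewrite /b; lra.
- by apply: hb; rewrite /b; lra.
- by rewrite subrr normr0.
Qed.

Lemma ray_contradiction p e : ~ K p -> p.1.1 != 0 -> 0 < rho p -> 0 < e ->
  (forall t, 0 <= t ->
    e <= W (ray p t) + Om ^+ 2 * rcyl (ray p t) ^+ 2 / 2 + lam) -> False.
Proof.
move=> Kp p0 rp e0 He.
have [s s0 hs] := Aprime_small f1 f2 e0.
pose h (t : R) := rho (ray p `|t|).
have nh t : 0 < h t -> h t < s -> False.
  move=> h0 hts; have Kt := ray_notin Kp (normr_ge0 t).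
  by have := hs _ h0 hts; rewrite rho_eq// ltNge He.
have h00 : s <= h 0.
  have h0 : 0 < h 0.
    by rewrite /h normr0 /ray !mul0r !addr0 -!surjective_pairing.
  by rewrite leNgt; apply/negP => /(nh _ h0).
have hle t : 0 <= t -> s <= h t.
  move=> t0; rewrite leNgt; apply/negP => hts.
  have ht0 : h t <= 0 by rewrite leNgt; apply/negP => /nh; exact.
  (* By [nh] no value lies strictly between 0 and [s], yet a fall from at least [s] to at most 0
     passes through [s / 2]. *)
  have [||c _ hc] := @IVT R h 0 t (s / 2) t0.
  - exact/continuous_subspaceT/ray_continuous.
  - by rewrite ge_min le_max; apply/andP; split; apply/orP; [right|left]; lra.
  by apply: (nh c); rewrite hc; lra.
have [a a0 ha] := Aprime_bounded f1 f2 C.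
have r0 : 0 < rcyl p ^+ 2.
  by rewrite rcyl_sqr ltr_pwDl ?sqr_ge0// exprn_even_gt0.
pose k := Om ^+ 2 * rcyl p ^+ 2 / 2.
have k0 : 0 < k by rewrite divr_gt0// mulr_gt0// exprn_gt0.
(* At this parameter the centrifugal term exceeds [a - lam], where [a] bounds [Aprime f] on the
   range of [rho]. *)
pose t := (a + `|lam| + 1) / k.
have t0 : 0 <= t by rewrite divr_ge0 ?(ltW k0)// !addr_ge0// ltW.
have Kt := ray_notin Kp t0.
have ht := hle t t0; rewrite /h ger0_norm// in ht.
have rt : 0 < rho (ray p t) by exact: lt_le_trans ht.
have := ha _ rt (le_trans (ler_norm _) (rho_bound Kt)).
rewrite rho_eq// rcyl_ray.
have -> : Om ^+ 2 * ((1 + t) ^+ 2 * rcyl p ^+ 2) / 2 = (1 + t) ^+ 2 * k.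
  by rewrite /k; ring.
have tk : t * k = a + `|lam| + 1 by rewrite /t divfK// gt_eqF.
have : t * k <= (1 + t) ^+ 2 * k.
  by rewrite ler_wpM2r ?(ltW k0)//; nra.
have := W0 (ray p t); have := ler_norm (- lam); rewrite normrN; lra.
Qed.

End Ray.

(** * Interior maximum of a potential with a quadratic penalty *)

Section InteriorMaximum.
Variable R : realType.
Implicit Types (x y : pt R).

Definition cube x : set (pt R) :=
  (`[x.1.1 - 1, x.1.1 + 1] `*` `[x.1.2 - 1, x.1.2 + 1]) `*` `[x.2 - 1, x.2 + 1].

Lemma cubeP x y : cube x y <->
  [/\ `|y.1.1 - x.1.1| <= 1, `|y.1.2 - x.1.2| <= 1 & `|y.2 - x.2| <= 1].
Proof.
rewrite !ler_distl /cube /=; split=> [[[/=]]|[]]; rewrite !in_itv/=.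
  by move=> -> -> ->.
by move=> h1 h2 h3; split => //; split.
Qed.

Lemma compact_cube x : compact (cube x).
Proof. by apply: compact_setX; first apply: compact_setX; exact: segment_compact. Qed.

Lemma mem_six_points x (s : R) p : 0 < s -> p \in six_points x s -> ball x (2 * s) p.
Proof.
move=> s0 px; have s2 : s < 2 * s by lra.
apply/ball_pt; move: px; rewrite !inE.
by do 5?[case/predU1P => [->|]]; last move/eqP => ->; split => /=;
  rewrite ?subrr ?normr0 ?mulr_gt0// ?opprD ?opprB ?addrA ?subrr ?add0r ?addrC ?addNKr
  ?addrNK ?subrK ?normrN ?gtr0_norm.
Qed.

Lemma sum_six_points_dist3 x y (s : R) :
  \sum_(p <- six_points x s) dist3 p y ^+ 2 = 6 * dist3 x y ^+ 2 + 6 * s ^+ 2.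
Proof. by rewrite /six_points !big_cons big_nil !dist3_sqr /=; ring. Qed.

Lemma sum_six_points_rcyl x (s : R) :
  \sum_(p <- six_points x s) rcyl p ^+ 2 = 6 * rcyl x ^+ 2 + 4 * s ^+ 2.
Proof. by rewrite /six_points !big_cons big_nil !rcyl_sqr /=; ring. Qed.

Variables (V rho : pt R -> R) (x0 : pt R) (a kap s0 : R).
Hypotheses (cV : continuous V) (crho : {within cube x0, continuous rho}).
Hypotheses (s00 : 0 < s0) (rx0 : s0 <= rho x0) (Vx0 : 0 < V x0) (akap : a < kap).
Hypothesis Va : forall y, cube x0 y -> 0 < rho y -> V y <= a.
Hypothesis Vs : forall y, cube x0 y -> 0 < rho y -> rho y < s0 -> V y < V x0.

Let w y := V y - kap * dist3 y x0 ^+ 2.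

Let cw : continuous w.
Proof.
apply: continuous_ptP => y e e0.
have /cvgrPdist_lt/(_ e e0) : w z @[z --> y] --> w y.
  apply: cvgB; first exact: cV.
  apply: cvgM; first exact: cvg_cst.
  have -> : (fun z => dist3 z x0 ^+ 2) = (fun z => dist3 x0 z * dist3 x0 z).
    by apply/funext => z; rewrite dist3C expr2.
  by rewrite dist3C expr2; apply: cvgM; exact: dist3_continuous.
move=> h; have : nbhs (y : pt R) [set z | `|w y - w z| < e] by [].
by move=> /nbhs_ballP[d /= d0 hd]; exists d => // z; exact: hd.
Qed.

(** The maximum is sought where [rho >= s0], since [V] is controlled only where [rho] is positive;
    the non-strict inequality keeps this set compact. *)
Let F := cube x0 `&` [set y | s0 <= rho y].

Let cube0 : cube x0 x0.
Proof. by apply/cubeP; rewrite !subrr normr0 ler01. Qed.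

Let compactF : compact F.
Proof.
apply: (subclosed_compact _ (@compact_cube x0)); last by move=> y [].
move=> y yF.
have cy : cube x0 y.
  have /closure_id -> : closed (cube x0).
    apply: compact_closed (@compact_cube x0).
    exact: norm_hausdorff.
  by apply: closureS yF => z [].
split => //=; rewrite leNgt; apply/negP => ry.
have e0 : 0 < s0 - rho y by rewrite subr_gt0.
have [d d0 hd] := within_ptP crho cy e0.
have [z [[cz /= rz] yz]] := yF _ (nbhsx_ballx y _ d0).
have := hd z cz yz; rewrite ltr_norml => /andP[h1 h2]; lra.
Qed.

(** A maximiser of [w] on [F] is a local maximum in full space: the penalty keeps it off the faces
    of the cube, and at neighbours with [rho < s0] the potential is below [V x0]. *)
Lemma interior_max : exists x1, cube x0 x1 /\ exists2 d, 0 < d &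
  forall s, 0 < s -> s < d -> forall p, p \in six_points x1 s ->
    V p - kap * dist3 p x0 ^+ 2 <= V x1 - kap * dist3 x1 x0 ^+ 2.
Proof.
have [|x1] := compact_EVT_max _ compactF (continuous_subspaceT cw).
  by exists x0.
rewrite inE => -[cx1 /= rx1] x1max.
have w0 : w x0 = V x0.
  by rewrite /w /dist3 !subrr expr0n !addr0 sqrtr0 expr0n mulr0 subr0.
have wx1 : V x0 <= w x1 by rewrite -w0; apply: x1max; rewrite inE.
have rx00 := lt_le_trans s00 rx0.
have kap0 : 0 < kap by exact: le_lt_trans (le_trans (ltW Vx0) (Va cube0 rx00)) akap.
(* At distance 1 or more the penalty is at least [kap > a >= V x1], making [w x1] negative, although
   [w x1 >= V x0 > 0]. *)
have d1 : dist3 x1 x0 < 1.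
  rewrite ltNge; apply/negP => d1.
  have := Va cx1 (lt_le_trans s00 rx1).
  have : kap <= kap * dist3 x1 x0 ^+ 2 by rewrite ler_peMr ?exprn_ege1// ltW.
  by move: wx1; rewrite /w; have := Vx0; have := akap; lra.
have [b1 b2 b3] := coord_le_dist3 x1 x0.
have rx10 : 0 < rho x1 by exact: lt_le_trans rx1.
have [d d0 hd] := within_ptP crho cx1 rx10.
exists x1; split => //; exists (Num.min d (1 - dist3 x1 x0) / 2).
  by rewrite divr_gt0// lt_min d0 subr_gt0.
move=> s sp; rewrite ltr_pdivlMr// mulrC lt_min => /andP[sd s1] p /(mem_six_points sp) bp.
have [p1 p2 p3] := (ball_pt _ _ _).1 bp.
have tri (u v r : R) : `|u - v| < 2 * s -> `|u - r| <= dist3 x1 x0 -> `|v - r| <= 1.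
  move=> uv ur; rewrite -(subrK u v) -addrA; apply: le_trans (ler_normD _ _) _.
  by rewrite distrC; lra.
have cp : cube x0 p by apply/cubeP; split; apply: tri; eassumption.
have := hd p cp (le_ball (ltW sd) bp); rewrite ltr_norml => /andP[_ rp].
have rp0 : 0 < rho p by lra.
have [sr|rs] := leP s0 (rho p); first by apply: x1max; rewrite inE.
apply: le_trans wx1; apply: le_trans (ltW (Vs cp rp0 rs)).
by rewrite gerBl mulr_ge0 ?sqr_ge0// ltW.
Qed.

End InteriorMaximum.

(** * Solutions of the rotating star equation and the choice of the threshold *)

Section Star.
Variables (R : realType) (f : R -> R) (K : set (pt R)) (rhoK : pt R -> R) (M C Q mK : R).
Hypotheses (f1 : F1 f) (f2 : F2 f) (oK : open K) (nt : no_trapping K) (M0 : 0 < M).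
Hypotheses (C0 : 0 <= C) (Kb : forall p, K p -> enorm3 p <= C).
Hypotheses (mrK : measurable_fun K rhoK) (rK0 : forall y, K y -> 0 <= rhoK y).
Hypotheses (hQ : (\int[@leb3 R]_(y in K) (rhoK y ^+ 2)%:E <= Q%:E)%E)
  (hmK : (\int[@leb3 R]_(y in K) (rhoK y)%:E <= mK%:E)%E).

(** The bound [B] may depend on [Om]; [solution_bounded] provides a uniform one off the plane
    [x1 = 0]. *)
Definition solution (Om : R) (rho : pt R -> R) (lam : R) : Prop :=
  [/\ {within ~` K, continuous rho},
      exists B : R, forall x, ~ K x -> `|rho x| <= B,
      forall x, ~ K x -> 0 <= rho x,
      (\int[@leb3 R]_(x in ~` K) (rho x)%:E = M%:E)%E &
      forall x, ~ K x -> 0 < rho x ->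
        Aprime f (rho x) - Bop K rho x - Om ^+ 2 * rcyl x ^+ 2 / 2 - PhiK K rhoK x = lam].


(* The complement of K without the null plane x1 = 0: there every radial ray leaves to
   infinity, while the plane may contain parts of the complement invisible to the integral. *)
Let D : set (pt R) := ~` K `\` (([set 0] `*` setT) `*` setT).

Let mK' : measurable K. Proof. exact: open_pt_measurable. Qed.

Let mplane : measurable (([set 0] `*` setT) `*` setT : set (pt R)).
Proof. by apply: measurableX => //; exact: measurableX. Qed.

Let mD : measurable D.
Proof. by apply: measurableD => //; exact: measurableC. Qed.

Let DP x : D x <-> ~ K x /\ x.1.1 != 0.
Proof.
rewrite /D; split => [[Kx /= px]|[Kx /eqP px]]; split => //.
- by apply/eqP => p; apply: px.
- by move=> [[/= p _] _]; exact: px.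
Qed.

Let mK0 : 0 <= mK.
Proof. by rewrite -lee_fin; apply: le_trans hmK; apply: integral_ge0. Qed.

Let nbK e : 0 < e -> exists2 eta, 0 < eta & near_bound K rhoK eta e.
Proof. exact: (near_bound_sqr_small mK' mrK rK0 hQ). Qed.

Let PhiK_ge0 x : 0 <= PhiK K rhoK x. Proof. exact: (newton_pot_ge0 rK0). Qed.

Let PhiK_bounded : exists2 c, 0 < c & forall x, PhiK K rhoK x <= c.
Proof.
have [eta e0 nb] := nbK ltr01.
exists (1 + mK / eta) => [|x]; first by rewrite ltr_pwDl// divr_ge0// ltW.
exact: (newton_pot_le mK' mrK rK0 hmK x e0 nb).
Qed.

Let PhiK_continuous : continuous (PhiK K rhoK).
Proof. exact: (newton_pot_continuous mK' mrK rK0 hmK nbK). Qed.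

Section Solution.
Variables (Om : R) (rho : pt R -> R) (lam : R).
Hypothesis sol : solution Om rho lam.

Let mrho : measurable_fun (~` K) rho.
Proof. by have [c _ _ _ _] := sol; apply: within_measurable => //; exact: measurableC. Qed.

Lemma measurable_solution : measurable_fun D rho.
Proof. by apply: measurable_funS mrho => //; [exact: measurableC|move=> x []]. Qed.

Lemma solution_ge0 x : D x -> 0 <= rho x.
Proof. by have [_ _ r0 _ _] := sol; move=> [Kx _]; exact: r0. Qed.

Let int_plane (u : pt R -> R) : measurable_fun (~` K) u -> (forall y, ~ K y -> 0 <= u y) ->
  (\int[@leb3 R]_(y in ~` K) (u y)%:E = \int[@leb3 R]_(y in D) (u y)%:E)%E.
Proof.
move=> mu u0; apply: ge0_negligible_integral => //.
- exact: measurableC.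
- exact/measurable_EFinP.
- exact: leb3_plane.
Qed.

Lemma solution_mass : (\int[@leb3 R]_(y in D) (rho y)%:E = M%:E)%E.
Proof. by have [_ _ r0 <- _] := sol; rewrite int_plane. Qed.

Lemma solution_mass_le : (\int[@leb3 R]_(y in D) (rho y)%:E <= M%:E)%E.
Proof. by rewrite solution_mass. Qed.

Lemma BopE x : Bop K rho x = newton_pot D rho x.
Proof.
have [_ _ r0 _ _] := sol; rewrite /Bop /newton_pot int_plane//.
  apply: measurable_funM => //.
  by have := @measurable_dist3V R 1 (~` K) x; under eq_fun do rewrite expr1.
by move=> y Ky; rewrite divr_ge0 ?dist3_ge0// r0.
Qed.

Lemma solution_eq x : ~ K x -> 0 < rho x ->
  Aprime f (rho x) = (newton_pot D rho x + PhiK K rhoK x)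
    + Om ^+ 2 * rcyl x ^+ 2 / 2 + lam.
Proof.
by have [_ _ _ _ e] := sol; move=> Kx rx; rewrite -(e x Kx rx) BopE; ring.
Qed.

Let W0 x : 0 <= newton_pot D rho x + PhiK K rhoK x.
Proof. by rewrite addr_ge0 ?PhiK_ge0//; exact: (newton_pot_ge0 solution_ge0). Qed.

Lemma solution_ray p e : 0 < Om -> D p -> 0 < rho p -> 0 < e ->
  (forall t, 0 <= t -> e <= newton_pot D rho (ray p t) + PhiK K rhoK (ray p t)
     + Om ^+ 2 * rcyl (ray p t) ^+ 2 / 2 + lam) -> False.
Proof.
move=> Om0 /DP[Kp p0] rp e0 He; have [rc [B rB] _ _ _] := sol.
exact: (ray_contradiction f1 f2 nt rc rB W0 Om0 solution_eq Kp p0 rp e0 He).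
Qed.

(** The equation at [p] makes the centrifugal term plus [lam] at least [e] there; along the ray this
    sum only grows, and the potentials are non-negative. *)
Lemma solution_ray_start p e : 0 < Om -> D p -> 0 < rho p -> 0 < e ->
  newton_pot D rho p + PhiK K rhoK p + e <= Aprime f (rho p) -> False.
Proof.
move=> Om0 Dp rp e0; have [Kp p0] := (DP p).1 Dp; rewrite solution_eq// => He.
apply: (solution_ray Om0 Dp rp e0) => t t0; have := W0 (ray p t).
have : Om ^+ 2 * rcyl p ^+ 2 / 2 <= Om ^+ 2 * rcyl (ray p t) ^+ 2 / 2.
  rewrite rcyl_ray ler_wpM2r// ler_wpM2l ?sqr_ge0// ler_peMl ?sqr_ge0//.
  by rewrite exprn_ege1// lerDl.
lra.
Qed.

End Solution.

(* If sup rho = S is large, A'(rho) ~ S^(1/3+) beats B rho <= (64 + M) S^(1/3) at a point where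
   rho is comparable to S. *)
Lemma solution_bounded : exists2 S, 0 < S &
  forall Om rho lam, 0 < Om -> solution Om rho lam -> forall x, D x -> rho x <= S.
Proof.
have [c c0 hc] := PhiK_bounded.
(* The factor 2 pays for working at a point with [rho p > S / 2], where only
   [croot (rho p) >= croot S / 2] is used. *)
have [s s0 hs] := Aprime_superlinear f1 f2 (2 * (64 + M + c + 1)).
exists (Num.max 1 (2 * s)) => [|Om rho lam Om0 sol x1 Dx1]; first by rewrite lt_max ltr01.
rewrite leNgt; apply/negP; rewrite gt_max => /andP[r1 r2].
have [_ [B rB] r0 _ _] := sol.
pose E := rho @` D.
have supE : has_sup E.
  split; first by exists (rho x1), x1.
  exists B => _ [y Dy <-]; apply: le_trans (ler_norm _) _.
  by apply: rB; have [] := (DP y).1 Dy.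
pose S := sup E.
have rS y : D y -> rho y <= S.
  by move=> Dy; apply: (ub_le_sup supE.2); exists y.
have S1 : 1 < S by exact: lt_le_trans r1 (rS _ Dx1).
have S2 : 2 * s < S by exact: lt_le_trans r2 (rS _ Dx1).
have S0 : 0 < S by lra.
have S02 : 0 < S / 2 by rewrite divr_gt0.
have [_ [p Dp <-]] := sup_adherent S02 supE; rewrite -/S => Sp.
have rp : S / 2 < rho p by lra.
have rp0 : 0 < rho p by lra.
have cS := croot_gt0 S0.
(* Splitting the kernel at [1 / croot S] balances the near part [64 * S * eta^2] with the far part
   [M / eta]. *)
have eS : 0 < (croot S)^-1 by rewrite invr_gt0.
have nb := near_bound_bounded mD (measurable_solution sol) (solution_ge0 sol) (ltW S0) rS eS.
have := newton_pot_le mD (measurable_solution sol) (solution_ge0 sol)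
  (solution_mass_le sol) p eS nb.
have -> : 64 * S * (croot S)^-1 ^+ 2 + M / (croot S)^-1 = (64 + M) * croot S.
  by rewrite -{1}(crootK (ltW S0)); field; rewrite gt_eqF.
have cS1 : 1 <= croot S by rewrite le_croot ?expr1n ?(ltW S1) ?(ltW S0).
have cp : croot S / 2 <= croot (rho p).
  rewrite le_croot ?(ltW rp0)//; last by rewrite divr_ge0// ltW.
  by rewrite expr_div_n crootK ?(ltW S0)//; lra.
have sp : s <= rho p by lra.
have := hs _ sp.
have := hc p => h1 h2 h3.
apply: (solution_ray_start sol Om0 Dp rp0 ltr01); apply: le_trans h2.
have N0 : 0 <= 64 + M + c + 1 by have := M0; lra.
have := ler_wpM2l N0 cp.
have : (c + 1) * 1 <= (c + 1) * croot S by rewrite ler_wpM2l//; lra.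
lra.
Qed.


(** One unit is for the cube around a far point, the other for the distance of that cube to [K]. *)
Let H := C + 2.

Definition far (x : pt R) := [\/ H < `|x.1.1|, H < `|x.1.2| | H < `|x.2| ].

Let abs_far (a b c : R) : H < `|a| -> `|b - a| <= 1 -> `|c| <= C -> 1 <= `|b - c|.
Proof.
move=> Ha ba cC.
have : `|a| <= `|b - a| + (`|b - c| + `|c|).
  rewrite [X in `|X| <= _](_ : a = - (b - a) + ((b - c) + c)); last by ring.
  by apply: le_trans (ler_normD _ _) _; rewrite normrN lerD2l ler_normD.
by move: Ha; rewrite /H; lra.
Qed.

Lemma far_cube x y z : far x -> cube x y -> K z -> 1 <= dist3 y z.
Proof.
move=> fx /cubeP[c1 c2 c3] Kz.
have [z1 z2 z3] := coord_le_enorm3 z; have zC := Kb Kz.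
have [y1 y2 y3] := coord_le_dist3 y z.
case: fx => fx.
- by apply: le_trans y1; apply: abs_far fx c1 (le_trans z1 zC).
- by apply: le_trans y2; apply: abs_far fx c2 (le_trans z2 zC).
- by apply: le_trans y3; apply: abs_far fx c3 (le_trans z3 zC).
Qed.

Lemma dist3_notin y : (forall z, K z -> 1 <= dist3 y z) -> ~ K y.
Proof.
move=> h /h; rewrite /dist3 !subrr expr0n !addr0 sqrtr0.
by apply/negP; rewrite -ltNge.
Qed.

(** A point of the plane [x1 = 0] is shifted slightly in the [x1] direction, by less than 1 so as
    not to meet [K], and continuity carries the bound over. *)
Lemma bounded_off_plane (rho : pt R -> R) (S : R) y : {within ~` K, continuous rho} ->
  (forall x, D x -> rho x <= S) -> (forall z, K z -> 1 <= dist3 y z) -> rho y <= S.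
Proof.
move=> rc rS yK; have Ky := dist3_notin yK.
have [y0|y0] := eqVneq y.1.1 0; last by apply: rS; apply/DP.
rewrite leNgt; apply/negP => Sy.
have e0 : 0 < rho y - S by rewrite subr_gt0.
have [d d0 hd] := within_ptP rc Ky e0.
pose t := Num.min d 1 / 2.
have t0 : 0 < t by rewrite divr_gt0// lt_min d0 ltr01.
have td : t < d.
  by have : Num.min d 1 <= d by [rewrite ge_min lexx]; rewrite /t; lra.
have t1 : t < 1.
  by have : Num.min d 1 <= 1 by [rewrite ge_min lexx orbT]; rewrite /t; lra.
pose z : pt R := ((t, y.1.2), y.2).
have yz : dist3 y z = t.
  by rewrite /dist3 /z /= y0 !subrr sub0r sqrrN expr0n !addr0 sqrtr_sqr gtr0_norm.
have Kz : ~ K z by move=> /yK; rewrite yz leNgt t1.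
have Dz : D z by apply/DP; split => //=; rewrite gt_eqF.
have bz : ball y d z.
  by apply/ball_pt; rewrite /z /= y0 !subrr normr0 sub0r normrN gtr0_norm.
have := hd z Kz bz; rewrite ltr_norml => /andP[_].
have := rS z Dz; lra.
Qed.

(* Away from K the potential is subharmonic with Laplacian at least 2 Om^2 - O(S), so for large
   Om the function A'(rho) - kap |x - x0|^2 has no interior maximum. *)
Lemma solution_far S : 0 < S -> exists2 Om1, 0 < Om1 &
  forall Om rho lam, Om1 < Om -> solution Om rho lam ->
    (forall x, D x -> rho x <= S) -> forall x, far x -> rho x <= 0.
Proof.
move=> S0; have [a a0 ha] := Aprime_bounded f1 f2 S.
pose kap := a + 1.
exists (7680 * S + 6 * mK + 6 * kap + 1) => [|Om rho lam Om1 sol rS x0 fx0].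
  by rewrite /kap; have := mK0; lra.
rewrite leNgt; apply/negP => rx0.
have [rc _ r0 _ _] := sol.
have mr := measurable_solution sol; have rg := solution_ge0 sol.
have rm := solution_mass_le sol.
have nb e (e0 : 0 < e) := near_bound_bounded_small mD mr rg (ltW S0) rS e0.
have cB : continuous (newton_pot D rho).
  apply: (newton_pot_continuous mD mr rg rm) => e e0.
  by exists (eta_bounded S e); [exact: (eta_bounded_gt0 (ltW S0) e0)|exact: (nb e e0)].
have cubeK y : cube x0 y -> ~ K y by move=> cy; apply: dist3_notin => z; exact: far_cube cy.
have cube_S y : cube x0 y -> rho y <= S.
  by move=> cy; apply: bounded_off_plane rc rS _ => z; exact: far_cube cy.
pose V y := newton_pot D rho y + PhiK K rhoK y + Om ^+ 2 * rcyl y ^+ 2 / 2 + lam.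
have VE y : ~ K y -> 0 < rho y -> Aprime f (rho y) = V y by exact: solution_eq.
have cV : continuous V.
  move=> y; apply: cvgD; last exact: cvg_cst.
  apply: cvgD; first by apply: cvgD; [exact: cB|exact: PhiK_continuous].
  apply: cvgM; last exact: cvg_cst.
  apply: cvgM; first exact: cvg_cst.
  have -> : (fun z : pt R => rcyl z ^+ 2) = (fun z => z.1.1 * z.1.1 + z.1.2 * z.1.2).
    by apply/funext => z; rewrite rcyl_sqr !expr2.
  have c1 : continuous (fun z : pt R => z.1.1).
    apply: continuous_ptP => z e e0; exists e => // z' /ball_pt[]//.
  have c2 : continuous (fun z : pt R => z.1.2).
    apply: continuous_ptP => z e e0; exists e => // z' /ball_pt[]//.
  rewrite rcyl_sqr !expr2.
  by apply: cvgD; apply: cvgM; [exact: c1|exact: c1|exact: c2|exact: c2].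
have cx0 : cube x0 x0 by apply/cubeP; rewrite !subrr normr0 ler01.
have Kx0 := cubeK _ cx0.
(* The sign comes from the equation itself: [V x0] equals [Aprime f (rho x0)], which is positive. *)
have Vx0 : 0 < V x0.
  rewrite -VE//; apply: lt_le_trans (Aprime_ge f1 rx0).
  by rewrite divr_gt0// f_gt0.
have [s0 s00 hs] := Aprime_small f1 f2 Vx0.
have rx0' : s0 <= rho x0.
  by rewrite leNgt; apply/negP => h; have := hs _ rx0 h; rewrite VE// ltxx.
have akap : a < kap by rewrite /kap ltrDl.
have crho : {within cube x0, continuous rho} by exact: continuous_subspaceW cubeK rc.
have [|y cy ry|x1 [cx1 [d d0 hd]]] := interior_max cV crho s00 rx0' Vx0 akap.
- by move=> y cy ry; rewrite -(VE _ (cubeK _ cy) ry); apply: ha => //; exact: cube_S.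
- by move=> rys; rewrite -(VE _ (cubeK _ cy) ry); exact: hs.
(* [s < d] keeps the six points under the local maximum; [4 * s <= 1] keeps the near kernel away
   from [K]. *)
pose s := Num.min d 4^-1 / 2.
have m1 : Num.min d 4^-1 <= d by rewrite ge_min lexx.
have m2 : Num.min d 4^-1 <= 4^-1 by rewrite ge_min lexx orbT.
have m3 : 0 < Num.min d 4^-1 by rewrite lt_min d0 invr_gt0 ltr0n.
have sp : 0 < s by rewrite divr_gt0.
have sd : s < d by rewrite /s; lra.
have s4 : 4 * s <= 1 by rewrite /s; lra.
have hB := newton_pot_six_points mD mr rg rm sp (eta_bounded_gt0 (ltW S0) ltr01)
  (nb _ ltr01) (six_points_error_bounded mD mr rg (ltW S0) rS x1 sp).
have [eta e0 nbe] := nbK ltr01.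
have hK := newton_pot_six_points mK' mrK rK0 hmK sp e0 nbe
  (six_points_error_far mK' mrK rK0 hmK sp s4 (fun y => far_cube fx0 cx1)).
have hmax : \sum_(p <- six_points x1 s) (V p - kap * dist3 p x0 ^+ 2) <=
    6 * (V x1 - kap * dist3 x1 x0 ^+ 2).
  have -> : 6 * (V x1 - kap * dist3 x1 x0 ^+ 2) =
     \sum_(p <- six_points x1 s) (V x1 - kap * dist3 x1 x0 ^+ 2).
    by rewrite /six_points !big_cons big_nil; ring.
  by rewrite big_seq [leRHS]big_seq; apply: ler_sum => p; exact: hd.
move: hmax; rewrite sumrB -mulr_sumr sum_six_points_dist3.
have -> : \sum_(p <- six_points x1 s) V p =
   \sum_(p <- six_points x1 s) newton_pot D rho p +
   \sum_(p <- six_points x1 s) PhiK K rhoK p +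
   Om ^+ 2 / 2 * (6 * rcyl x1 ^+ 2 + 4 * s ^+ 2) + 6 * lam.
  rewrite -sum_six_points_rcyl mulr_sumr /V !big_split/=; congr (_ + _ + _ + _).
    by apply: eq_bigr => p _; ring.
  by rewrite /six_points !big_cons big_nil; ring.
rewrite /V; move: hB hK; rewrite -/(PhiK K rhoK).
move=> hB hK hmax.
have s1 : s ^+ 2 <= 1 by rewrite exprn_ile1 ?(ltW sp)//; lra.
have s20 : 0 < s ^+ 2 by rewrite exprn_gt0.
(* The centrifugal term contributes [2 * Om^2 * s^2] to the second difference of [V], and the
   maximum allows at most [6 * kap * s^2]; the rest is the error of the two potentials. *)
have key : 2 * Om ^+ 2 * s ^+ 2 <= (7680 * S + 6 * mK + 6 * kap) * s ^+ 2.
  have : 6 * mK * s ^+ 4 <= 6 * mK * s ^+ 2.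
    rewrite ler_wpM2l//; first by have := mK0; lra.
    have -> : s ^+ 4 = s ^+ 2 * s ^+ 2 by ring.
    by rewrite ler_piMl// ltW.
  lra.
move: key; rewrite ler_pM2r//; apply/negP; rewrite -ltNge.
have b0 : 0 <= 7680 * S + 6 * mK + 6 * kap by rewrite /kap; have := mK0; lra.
have Om0 : 1 <= Om by lra.
have : Om <= Om ^+ 2 by rewrite expr2 ler_peMl//; lra.
lra.
Qed.

(** Otherwise [rho] is at most [S] on the slab [|x1| < tau] of a fixed cube and at most [sig] on the
    rest of it. The constants make these contributions [M / 4] and [M / 8], and the dyadic bound
    gives mass at most [M / 2]. *)
Lemma solution_mass_point S : 0 < S -> exists tau sig, [/\ 0 < tau, 0 < sig &
  forall Om rho lam, solution Om rho lam -> (forall x, D x -> rho x <= S) ->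
    (forall x, far x -> rho x <= 0) ->
    exists p, [/\ D p, tau <= `|p.1.1| & sig <= rho p]].
Proof.
move=> S0; pose L := H + 1.
have L0 : 0 < L by rewrite /L /H; have := C0; lra.
have t0 : 0 < M / (32 * S * L ^+ 2) by rewrite divr_gt0// !mulr_gt0// exprn_gt0.
have s0 : 0 < M / (64 * L ^+ 3) by rewrite divr_gt0// !mulr_gt0// exprn_gt0.
exists (M / (32 * S * L ^+ 2)), (M / (64 * L ^+ 3)).
move: t0 s0; set tau := M / (32 * S * L ^+ 2); set sig := M / (64 * L ^+ 3) => t0 s0.
split => // Om rho lam sol rS rfar; apply: contrapT => np.
have small y : D y -> tau <= `|y.1.1| -> rho y <= sig.
  move=> Dy ty; rewrite leNgt; apply/negP => sy; apply: np; exists y.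
  by split; [exact: Dy|exact: ty|exact: (ltW sy)].
pose A k : set (pt R) := if k == 0%N then (ball 0 tau `*` ball 0 L) `*` ball 0 L
  else ball origin L.
pose c k : R := if k == 0%N then S else if k == 1%N then sig else 0.
suff : (\int[@leb3 R]_(y in D) (rho y)%:E <= (2 * (M / 4))%:E)%E.
  by rewrite (solution_mass sol) lee_fin; have := M0; lra.
apply: (@dyadic_integral_le _ _ _ _ _ _ A c) => //.
- exact: measurable_solution sol.
- exact: solution_ge0 sol.
- move=> k; rewrite /A; case: ifP => _; last exact: measurable_ball_pt.
  by apply: measurableX; first apply: measurableX; exact: measurable_ball.
- by move=> k; rewrite /c; do 2?[case: ifP => _]; rewrite ?(ltW S0) ?(ltW s0).
- move=> y Dy ry.
  have nf : ~ far y by move=> /rfar; rewrite leNgt ry.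
  have y1 : `|y.1.1| < L.
    by rewrite /L ltNge; apply/negP => h; apply: nf; apply: Or31; lra.
  have y2 : `|y.1.2| < L.
    by rewrite /L ltNge; apply/negP => h; apply: nf; apply: Or32; lra.
  have y3 : `|y.2| < L.
    by rewrite /L ltNge; apply/negP => h; apply: nf; apply: Or33; lra.
  have [ty|ty] := leP tau `|y.1.1|.
    exists 1%N; last exact: small.
    by apply/ball_pt; rewrite /origin /= !sub0r !normrN.
  exists 0%N; last exact: rS.
  by rewrite /A /= /ball /=; split => /=; [split => /=|]; rewrite sub0r normrN.
- move=> [|[|k]].
  + rewrite /A /c /= leb3_cuboid ?(ltW t0) ?(ltW L0)// -EFinM lee_fin expr0 divr1.
    rewrite le_eqVlt; apply/orP; left; apply/eqP.
    by rewrite /tau; field; rewrite !gt_eqF.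
  + rewrite /A /c /= leb3_ball ?(ltW L0)// -EFinM lee_fin expr1.
    rewrite le_eqVlt; apply/orP; left; apply/eqP.
    by rewrite /sig; field; rewrite gt_eqF.
  + by rewrite /c /= mul0e lee_fin !divr_ge0 ?exprn_ge0// ltW.
Qed.

Lemma no_fast_solution : exists2 Om0, 0 < Om0 &
  forall Om rho lam, Om0 < Om -> ~ solution Om rho lam.
Proof.
have [S S0 hS] := solution_bounded.
have [Om1 Om10 hfar] := solution_far S0.
have [tau [sig [tau0 sig0 hpoint]]] := solution_mass_point S0.
(* At [p] monotonicity gives [f (rho p) / rho p >= f sig / S = 4 * e]; two potentials may then lose
   [e] each. *)
pose e := f sig / S / 4.
have e0 : 0 < e by rewrite divr_gt0// divr_gt0// f_gt0.
have e20 : 0 < e / 2 by rewrite divr_gt0.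
have etaB0 : 0 < eta_bounded S (e / 2) := eta_bounded_gt0 (ltW S0) e20.
have [etaK etaK0 nbKe] := nbK e20.
pose d := Num.min (modulus M (eta_bounded S (e / 2)) e) (modulus mK etaK e).
have d0 : 0 < d.
  by rewrite lt_min; apply/andP; split; apply: modulus_gt0 => //; exact: ltW.
have eta10 : 0 < eta_bounded S 1 := eta_bounded_gt0 (ltW S0) ltr01.
have [cK cK0 hcK] := PhiK_bounded.
pose cB := 1 + M / eta_bounded S 1.
have cB0 : 0 <= cB by rewrite addr_ge0// divr_ge0// ltW.
have dt : 0 < d * tau by rewrite mulr_gt0.
(* Chosen so that beyond distance [d] the centrifugal gain exceeds the sum of the upper bounds of
   both potentials. *)
pose Om2 := (cB + cK) / (d * tau).
have Om20 : 0 <= Om2 by rewrite divr_ge0 ?(ltW dt)// addr_ge0// ltW.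
exists (Om1 + Om2 + 1) => [|Om rho lam Om12 sol]; first by lra.
have OmP : 0 < Om by lra.
have rS := hS _ _ _ OmP sol.
have Om11 : Om1 < Om by lra.
have [p [Dp tp sp]] := hpoint _ _ _ sol rS (hfar _ _ _ Om11 sol rS).
have [Kp _] := (DP p).1 Dp.
have rp0 : 0 < rho p by exact: lt_le_trans sp.
have mr := measurable_solution sol; have rg := solution_ge0 sol.
have rm := solution_mass_le sol.
have nb u (u0 : 0 < u) := near_bound_bounded_small mD mr rg (ltW S0) rS u0.
have Ap : 4 * e <= Aprime f (rho p).
  apply: le_trans (Aprime_ge f1 rp0).
  have -> : 4 * e = f sig / S by rewrite /e; field; rewrite gt_eqF.
  apply: ler_pM.
  - by rewrite ltW// f_gt0.
  - by rewrite invr_ge0 ltW.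
  - exact: f_le.
  - by rewrite lef_pV2 ?posrE// rS.
have r0 : tau <= rcyl p.
  apply: le_trans tp _; rewrite -sqrtr_sqr; apply: ler_wsqrtr.
  by rewrite lerDl sqr_ge0.
rewrite (solution_eq sol) // in Ap.
apply: (solution_ray sol OmP Dp rp0 e0) => t tge0.
have Br : 0 <= newton_pot D rho (ray p t) by exact: newton_pot_ge0 rg _.
have Pr := PhiK_ge0 (ray p t).
have kin : Om ^+ 2 * rcyl (ray p t) ^+ 2 / 2 =
    Om ^+ 2 * rcyl p ^+ 2 / 2 + Om ^+ 2 * rcyl p ^+ 2 * (t + t ^+ 2 / 2).
  by rewrite rcyl_ray; field.
have tt : t <= t + t ^+ 2 / 2 by rewrite lerDl divr_ge0// sqr_ge0.
have Or : 0 <= Om ^+ 2 * rcyl p ^+ 2 by rewrite mulr_ge0 ?sqr_ge0.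
(* Up to distance [d] equicontinuity leaves at least [2 * e]; farther out the centrifugal gain pays
   for the full loss of both potentials. *)
have [near|far'] := leP (dist3 p (ray p t)) d.
  move: near; rewrite le_min => /andP[d1 d2].
  have h1 := newton_pot_equicontinuous mD mr rg rm etaB0 e0 (nb _ e20) d1.
  have h2 := newton_pot_equicontinuous mK' mrK rK0 hmK etaK0 e0 nbKe d2.
  rewrite -/(PhiK K rhoK) in h2.
  have : 0 <= Om ^+ 2 * rcyl p ^+ 2 * (t + t ^+ 2 / 2).
    by rewrite mulr_ge0// (le_trans tge0).
  lra.
have hB := newton_pot_le mD mr rg rm p eta10 (nb _ ltr01).
have hK := hcK p.
have big : cB + cK <= Om ^+ 2 * rcyl p ^+ 2 * (t + t ^+ 2 / 2).
  apply: (@le_trans _ _ (Om ^+ 2 * rcyl p ^+ 2 * t)); last by rewrite ler_wpM2l.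
  have -> : Om ^+ 2 * rcyl p ^+ 2 * t = Om ^+ 2 * ((t * rcyl p) * rcyl p) by ring.
  apply: (@le_trans _ _ (Om ^+ 2 * (d * tau))).
    rewrite -ler_pdivrMr// -/Om2.
    have : Om <= Om ^+ 2 by rewrite expr2 ler_peMl//; lra.
    lra.
  rewrite ler_wpM2l ?sqr_ge0// ler_pM// ?(ltW d0) ?(ltW tau0)//.
  by rewrite -dist3_ray// ltW.
rewrite -/cB in hB; lra.
Qed.

End Star.

Theorem theorem5 (R : realType) (f : R -> R) (K : set (pt R))
    (q : R) (rhoK : pt R -> R) (M : R) :
  F1 f -> F2 f -> F3 f -> F4 f ->
  bounded_domain K -> axisym_set K ->
  3 < q ->
  in_Lq q K rhoK -> (forall y, K y -> 0 <= rhoK y) -> axisym_fun rhoK ->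
  no_trapping K ->
  0 < M ->
  exists Omega0 : R, 0 < Omega0 /\
    forall Omega : R, Omega0 < Omega ->
      ~ exists rho : pt R -> R,
          {within ~` K, continuous rho} /\
          (exists C : R, forall x, ~ K x -> `|rho x| <= C) /\
          (forall x, ~ K x -> 0 <= rho x) /\
          (\int[@leb3 R]_(x in ~` K) (rho x)%:E = M%:E)%E /\
          exists lambda : R, forall x, ~ K x -> 0 < rho x ->
            Aprime f (rho x) - Bop K rho x - Omega ^+ 2 * rcyl x ^+ 2 / 2
              - PhiK K rhoK x = lambda.
Proof.
move=> f1 f2 _ _ [oK [_ [_ [C hC]]]] _ q3 Lq rK0 _ nt M0.
(* The second moment of [rhoK] controls the singular part of its potential, the first its mass. *)
have q2 : 2%:R <= q by rewrite ltW// (lt_trans _ q3)// ltr_nat.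
have q1 : 1%:R <= q by rewrite (le_trans _ q2)// ler_nat.
have [Q hQ] := integral_expr_Lq oK hC Lq rK0 q2.
have [mK hmK] := integral_expr_Lq oK hC Lq rK0 q1.
have hC' p : K p -> enorm3 p <= Num.max C 0 by move=> /hC h; rewrite le_max h.
have C0 : 0 <= Num.max C 0 by rewrite le_max lexx orbT.
have [Om0 Om00 none] := no_fast_solution f1 f2 oK nt M0 C0 hC' Lq.1 rK0 hQ hmK.
exists Om0; split=> // Om Om0Om [rho [rc [rB [r0 [rM [lam re]]]]]].
exact: (none Om rho lam Om0Om).
Qed.
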